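(* Let $M$ be a $C$-totally real submanifold of real dimension $n$ ($n\ge 2$) in a Sasakian space form $\widetilde M(c)$ of dimension $2n+1$, and $X$ a unit tangent vector in $T_p^1M$, $p\in M$. Then $$\mathrm{Ric}(X)\le\frac{n-1}{4}\left(c+3+n\|H\|^2\right),$$ where $H$ is the mean curvature vector of $M$ in $\widetilde M(c)$ and $\mathrm{Ric}(X)$ is the Ricci curvature of $M$ at $X$. The equality sign holds for every unit tangent vector at $p$ if and only if either $p$ is a geodesic point, or $n=2$ and, at $p$, for some orthonormal tangent vectors $e_1,e_2$ and some suitable function $\mu$, $$\sigma(e_1,e_1)=3\mu\,\varphi e_1,\qquad \sigma(e_2,e_2)=\mu\,\varphi e_1,\qquad \sigma(e_1,e_2)=\mu\,\varphi e_2,$$ where $\sigma$ is the second fundamental form of the immersion of $M$ into $\widetilde M(c)$.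
   Context: A contact metric structure $(\eta,\xi,\varphi,g)$ on a $(2m+1)$-dimensional manifold $\widetilde M$ consists of a $1$-form $\eta$ with $\eta\wedge(d\eta)^m\ne 0$ everywhere, a vector field $\xi$ with $\eta(\xi)=1$ and $\mathcal L_\xi\eta=0$, a $(1,1)$-tensor field $\varphi$ and a Riemannian metric $g$ such that $\varphi\xi=0$, $\eta\circ\varphi=0$, $\eta(X)=g(X,\xi)$, $\varphi^2=-I+\eta\otimes\xi$, $d\eta(X,Y)=g(X,\varphi Y)$ and $g(X,Y)=g(\varphi X,\varphi Y)+\eta(X)\eta(Y)$. It is Sasakian if the natural almost Hermitian structure on $\widetilde M\times\mathbb R$ is integrable, equivalently if $(\widetilde\nabla_X\varphi)Y=g(X,Y)\xi-\eta(Y)X$ for all $X,Y$, where $\widetilde\nabla$ is the Levi-Civita connection of $g$. A $\varphi$-section is a plane in $T_p\widetilde M$ spanned by $X$ and $\varphi X$ for some nonzero $X\perp\xi$; its sectional curvature is called a $\varphi$-sectional curvature. A Sasakian space form $\widetilde M(c)$ is a Sasakian manifold of constant $\varphi$-sectional curvature $c$. A submanifold $M$ of a contact metric manifold is $C$-totally real if every tangent vector of $M$ belongs to the contact distribution $\ker\eta$, i.e. $\xi$ is normal to $M$. $T_p^1M$ is the set of unit vectors in $T_pM$; $\sigma$ is the second fundamental form of $M$ in $\widetilde M(c)$; $H=\frac1n\mathrm{trace}(\sigma)$; $p$ is a geodesic point if $\sigma=0$ at $p$. $\mathrm{Ric}(X)$ for a unit vector $X\in T_pM$ is the sum of the sectional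 curvatures (of the induced metric) of the planes spanned by $X$ and $e_j$, $j=2,\ldots,n$, where $\{X,e_2,\ldots,e_n\}$ is an orthonormal basis of $T_pM$. *)

(* Defs.v *)
From HB Require Import structures.
From mathcomp Require Import all_boot all_order all_algebra all_fingroup.
From mathcomp Require Import all_classical all_reals all_analysis.

Set Implicit Arguments.
Unset Strict Implicit.
Unset Printing Implicit Defensive.

Import Order.TTheory GRing.Theory Num.Theory.
Import numFieldNormedType.Exports.

Local Open Scope classical_set_scope.
Local Open Scope ring_scope.

(* Conventions: a point or a tangent vector in a chart is a row vector;
    a linear map acts on the right, so that phi(v) is [v *m phi] and the
    differential of F maps v to [v *m jacobian F x]; a covector is a column. *)

Fixpoint Ck (R : realType) (d : nat) (W : normedModType R) (k : nat)
    (U : set 'rV[R]_d) (F : 'rV[R]_d -> W) : Prop :=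
  (forall x, U x -> {for x, continuous F}) /\
  if k is k'.+1 then
    forall j : 'I_d, let e_j : 'rV[R]_d := delta_mx 0 j in
      (forall x, U x -> derivable F x e_j) /\ Ck k' U (fun x => 'D_e_j F x)
  else True.

Definition smooth (R : realType) (d : nat) (W : normedModType R)
    (U : set 'rV[R]_d) (F : 'rV[R]_d -> W) : Prop :=
  forall k, Ck k U F.

Record manifold (R : realType) (d : nat) := Manifold {
  space :> topologicalType;
  chart : Type;
  chart_dom : chart -> set space;
  chart_map : chart -> space -> 'rV[R]_d;
  chart_inv : chart -> 'rV[R]_d -> space;
  manifold_hausdorff : hausdorff_space space;
  manifold_countable : @second_countable space;
  chart_cover : forall p, exists i, chart_dom i p;
  chart_dom_open : forall i, open (chart_dom i);
  chart_cod_open : forall i, open (chart_map i @` chart_dom i);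
  chart_mapK : forall i p, chart_dom i p -> chart_inv i (chart_map i p) = p;
  chart_map_continuous : forall i p, chart_dom i p ->
    {for p, continuous (chart_map i)};
  chart_inv_continuous : forall i x, (chart_map i @` chart_dom i) x ->
    {for x, continuous (chart_inv i)};
  transition_smooth : forall i j,
    smooth (chart_map i @` (chart_dom i `&` chart_dom j))
           (chart_map j \o chart_inv i)
}.

Definition chart_cod (R : realType) (d : nat) (M : manifold R d) (i : chart M)
  : set 'rV[R]_d := chart_map i @` chart_dom i.

Section LocalGeometry.
Variables (R : realType) (d : nat).
Implicit Types (x u v : 'rV[R]_d) (X Y Z : 'rV[R]_d -> 'rV[R]_d).
Implicit Types (g : 'rV[R]_d -> 'M[R]_d) (eta : 'rV[R]_d -> 'cV[R]_d).

Definition inner (G : 'M[R]_d) u v : R := (u *m G *m v^T) 0 0.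

Definition pairing (a : 'cV[R]_d) v : R := (v *m a) 0 0.

Definition bracket X Y x : 'rV[R]_d := 'D_(X x) Y x - 'D_(Y x) X x.

(* The exterior derivative with the factor 1/2, which is the normalization for
   which d eta(X,Y) = g(X, phi Y) is compatible with the Sasakian identity. *)
Definition ext_d eta X Y x : R :=
  2^-1 * ('D_(X x) (fun y => pairing (eta y) (Y y)) x
          - 'D_(Y x) (fun y => pairing (eta y) (X y)) x
          - pairing (eta x) (bracket X Y x)).

Definition lie_form (xi : 'rV[R]_d -> 'rV[R]_d) eta Y x : R :=
  'D_(xi x) (fun y => pairing (eta y) (Y y)) x
  - pairing (eta x) (bracket xi Y x).

(* Gamma(u,v)^k = 1/2 (d_u g(v,e_l) + d_v g(u,e_l) - d_l g(u,v)) g^{lk} *)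
Definition christoffel g x u v : 'rV[R]_d :=
  (\row_l (2^-1 * ('D_u (fun y => inner (g y) v (delta_mx 0 l)) x
                   + 'D_v (fun y => inner (g y) u (delta_mx 0 l)) x
                   - 'D_(delta_mx 0 l) (fun y => inner (g y) u v) x)))
  *m invmx (g x).

Definition levi_civita g X Y x : 'rV[R]_d :=
  'D_(X x) Y x + christoffel g x (X x) (Y x).

Definition riemann g X Y Z x : 'rV[R]_d :=
  levi_civita g X (levi_civita g Y Z) x
  - levi_civita g Y (levi_civita g X Z) x
  - levi_civita g (bracket X Y) Z x.

(* Tensors are evaluated on vectors through their constant extensions. *)
Definition sectional g x u v : R :=
  inner (g x) (riemann g (cst u) (cst v) (cst v) x) u
  / (inner (g x) u u * inner (g x) v v - inner (g x) u v ^+ 2).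

Definition orthonormal_frame (G : 'M[R]_d) (e : 'I_d -> 'rV[R]_d) : Prop :=
  forall i j, inner G (e i) (e j) = (i == j)%:R.

(* For g x symmetric positive definite and u a unit vector, the sum does not
   depend on the orthonormal frame extending u. *)
Definition ricci g x u : R :=
  get [set r | exists (e : 'I_d -> 'rV[R]_d) (k : 'I_d),
    [/\ orthonormal_frame (g x) e, e k = u &
        r = \sum_(j | j != k) sectional g x u (e j)]].

End LocalGeometry.

(* The component of eta /\ (d eta)^m on the coordinate frame, up to a nonzero
   combinatorial factor. *)
Definition contact_volume (R : realType) (m : nat)
    (eta : 'rV[R]_m.*2.+1 -> 'cV[R]_m.*2.+1) (x : 'rV[R]_m.*2.+1) : R :=
  let e (j : 'I_m.*2.+1) : 'rV[R]_m.*2.+1 := delta_mx 0 j in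
  \sum_(s : 'S_m.*2.+1) (-1) ^+ s * pairing (eta x) (e (s ord0)) *
    \prod_(k < m) ext_d eta (cst (e (s (inord k.*2.+1))))
                            (cst (e (s (inord k.*2.+2)))) x.

(* Tensor fields are given by their components in each chart, subject to the
   tensorial change of coordinates. *)
Record contact_metric (R : realType) (m : nat) (M : manifold R m.*2.+1) :=
  ContactMetric {
  eta : chart M -> 'rV[R]_m.*2.+1 -> 'cV[R]_m.*2.+1;
  xi : chart M -> 'rV[R]_m.*2.+1 -> 'rV[R]_m.*2.+1;
  phi : chart M -> 'rV[R]_m.*2.+1 -> 'M[R]_m.*2.+1;
  metric : chart M -> 'rV[R]_m.*2.+1 -> 'M[R]_m.*2.+1;
  eta_smooth : forall i, smooth (chart_cod i) (eta i);
  xi_smooth : forall i, smooth (chart_cod i) (xi i);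
  phi_smooth : forall i, smooth (chart_cod i) (phi i);
  metric_smooth : forall i, smooth (chart_cod i) (metric i);
  tensoriality : forall i j x,
    (chart_map i @` (chart_dom i `&` chart_dom j)) x ->
    let t := chart_map j \o chart_inv i in let J := jacobian t x in
    [/\ eta i x = J *m eta j (t x),
        xi j (t x) = xi i x *m J,
        J *m phi j (t x) = phi i x *m J &
        metric i x = J *m metric j (t x) *m J^T];
  metric_sym : forall i x, chart_cod i x -> (metric i x)^T = metric i x;
  metric_pos : forall i x, chart_cod i x -> forall u, u != 0 ->
    0 < inner (metric i x) u u;
  contact : forall i x, chart_cod i x -> contact_volume (eta i) x != 0;
  eta_xi : forall i x, chart_cod i x -> pairing (eta i x) (xi i x) = 1;
  lie_xi_eta : forall i x, chart_cod i x -> forall u,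
    lie_form (xi i) (eta i) (cst u) x = 0;
  phi_xi : forall i x, chart_cod i x -> xi i x *m phi i x = 0;
  eta_phi : forall i x, chart_cod i x -> forall u,
    pairing (eta i x) (u *m phi i x) = 0;
  eta_metric : forall i x, chart_cod i x -> forall u,
    pairing (eta i x) u = inner (metric i x) u (xi i x);
  phi_sqr : forall i x, chart_cod i x -> forall u,
    u *m phi i x *m phi i x = - u + pairing (eta i x) u *: xi i x;
  d_eta : forall i x, chart_cod i x -> forall u v,
    ext_d (eta i) (cst u) (cst v) x = inner (metric i x) u (v *m phi i x);
  metric_phi : forall i x, chart_cod i x -> forall u v,
    inner (metric i x) u v
    = inner (metric i x) (u *m phi i x) (v *m phi i x)
      + pairing (eta i x) u * pairing (eta i x) v
}.

Section Sasakian.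
Variables (R : realType) (m : nat) (M : manifold R m.*2.+1).
Variable S : contact_metric M.

(* (nabla_u phi) v = nabla_u (phi v) - phi (nabla_u v) *)
Definition nabla_phi (i : chart M) (x u v : 'rV[R]_m.*2.+1)
  : 'rV[R]_m.*2.+1 :=
  levi_civita (metric S i) (cst u) (fun y => v *m phi S i y) x
  - levi_civita (metric S i) (cst u) (cst v) x *m phi S i x.

Definition sasakian : Prop :=
  forall i x, chart_cod i x -> forall u v,
    nabla_phi i x u v
    = inner (metric S i x) u v *: xi S i x - pairing (eta S i x) v *: u.

Definition sasakian_space_form (c : R) : Prop :=
  sasakian /\
  forall i x, chart_cod i x -> forall u, u != 0 ->
    inner (metric S i x) u (xi S i x) = 0 ->
    sectional (metric S i) x u (u *m phi S i x) = c.

End Sasakian.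

Section Immersion.
Variables (R : realType) (n d : nat) (M : manifold R n) (N : manifold R d).
Variable f : M -> N.

Definition local_rep (i : chart M) (a : chart N) : 'rV[R]_n -> 'rV[R]_d :=
  chart_map a \o f \o chart_inv i.

Definition local_dom (i : chart M) (a : chart N) : set 'rV[R]_n :=
  chart_map i @` (chart_dom i `&` f @^-1` chart_dom a).

Definition immersion : Prop :=
  continuous f /\
  forall i a, smooth (local_dom i a) (local_rep i a) /\
    forall x, local_dom i a x -> row_free (jacobian (local_rep i a) x).

End Immersion.

(* Submanifolds of an open subset of R^d with metric g, parametrized by F. *)
Section LocalSubmanifold.
Variables (R : realType) (n d : nat).
Variables (g : 'rV[R]_d -> 'M[R]_d) (F : 'rV[R]_n -> 'rV[R]_d).

Definition induced_metric (x : 'rV[R]_n) : 'M[R]_n :=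
  jacobian F x *m g (F x) *m (jacobian F x)^T.

(* Gauss formula: sigma(u,v) is the difference between the ambient covariant
   derivative of F_* v along F in the direction u and F_* (nabla_u v). *)
Definition second_form (x u v : 'rV[R]_n) : 'rV[R]_d :=
  'D_u (fun y => v *m jacobian F y) x
  + christoffel g (F x) (u *m jacobian F x) (v *m jacobian F x)
  - levi_civita induced_metric (cst u) (cst v) x *m jacobian F x.

Definition mean_curvature (x : 'rV[R]_n) : 'rV[R]_d :=
  n%:R^-1 *: \sum_(i < n) \sum_(j < n)
    invmx (induced_metric x) i j
      *: second_form x (delta_mx 0 i) (delta_mx 0 j).

End LocalSubmanifold.

Definition C_totally_real (R : realType) (n m : nat) (M : manifold R n)
    (N : manifold R m.*2.+1) (S : contact_metric N) (f : M -> N) : Prop :=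
  forall (i : chart M) (a : chart N) x, local_dom f i a x -> forall u,
    let F := local_rep f i a in
    pairing (eta S a (F x)) (u *m jacobian F x) = 0.

(* Main.v *)
(* Differentiating <F_* v, xi> = 0 and <F_* v, phi F_* w> = 0 along a C-totally
   real submanifold shows that sigma is normal to xi and that
   h(u,v,w) = <sigma(u,v), phi F_* w> is a symmetric cubic form.  Polarizing the
   constancy of the phi-sectional curvature, the ambient sectional curvature of
   a tangent plane is (c+3)/4, so by the Gauss equation, in an orthonormal frame
   with X = e_k,
     Ric(X) = (n-1)(c+3)/4 + sum_j sum_r (h_kkr h_jjr - h_kjr^2).
   With T_r = sum_j h_jjr and S = sum_(j<>k) h_jjk, completing squares shows
   that (n-1)/4 (c+3+n|H|^2) - Ric(X) is the sum of
     (n-1)/(4n) (h_kkk - (n+1)/(n-1) S)^2,   sum_(j<>k) (h_jjk - S/(n-1))^2,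
     sum_(r<>k) (2 (h_kkr - T_r/4)^2 + (n-2)/(8n) T_r^2)
   and the h_kjr^2 with k, j, r distinct.  The Ricci curvature does not depend
   on the frame, so equality for every X kills all these terms for every k: for
   n > 2 this forces h = 0, and for n = 2 a frame whose first vector is
   proportional to -phi H gives the stated form. *)
Require Import Defs.
From HB Require Import structures.
From mathcomp Require Import all_boot all_order all_algebra all_fingroup.
From mathcomp Require Import all_classical all_reals all_analysis.
From mathcomp Require Import ring lra.

Set Implicit Arguments.
Unset Strict Implicit.
Unset Printing Implicit Defensive.

Import Order.TTheory GRing.Theory Num.Theory.
Import numFieldNormedType.Exports.

Local Open Scope classical_set_scope.
Local Open Scope ring_scope.

(** * Directional derivatives and smooth maps *)

(** All data live in charts, and [smooth] speaks of iterated partial derivatives, whereas chain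
    rules need Fréchet differentiability and curvature needs commuting mixed derivatives; hence the
    calculus developed before any geometry. Covariant derivatives are taken along a map. For the
    identity this is the Levi-Civita connection; for the immersion it is the ambient connection
    pulled back, so fields along $M$ are never extended to the ambient space. Constant coordinate
    fields commute, so no bracket terms survive. The constant $(n-1)/4$ has the following origin.
    Once the $h_{jjk}$, $j \ne k$, are split into their mean and their deviations, a binary
    quadratic form in $h_{kkk}$ and $S$ remains. Its discriminant vanishes because
    $(n-1)^2+4n=(n+1)^2$, so it is a single square. The dichotomy of the equality case comes from
    the coefficient $(n-2)/(8n)$ of $T_r^2$, which is zero exactly for $n=2$. *)

Section LineCalculus.
Variables (R : realType) (V : normedModType R).
Implicit Types (f : V -> R) (z v w : V) (U : set V).

Lemma is_derive_line f z v (t : R) : derivable f (z + t *: v) v ->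
  is_derive t 1 (fun s : R => f (z + s *: v)) ('D_v f (z + t *: v)).
Proof.
move=> df.
have E : (fun h : R => h^-1 *: (((fun s : R => f (z + s *: v)) \o shift t) (h *: 1)
    - f (z + t *: v))) =
  (fun h : R => h^-1 *: ((f \o shift (z + t *: v)) (h *: v) - f (z + t *: v))).
  apply/funext => h /=; have -> : h *: (1 : R) = h by exact: mulr1.
  by congr (_ *: (f _ - _)); rewrite scalerDl addrCA.
by split; rewrite /derivable /derive E.
Qed.

(** Asking for differentiability on the symmetric range [|t| <= |a|] lets [a] have either sign, so
    that callers need no case split. *)
Lemma line_MVT f z v (a : R) :
  (forall t, `|t| <= `|a| -> derivable f (z + t *: v) v) ->
  exists c, `|c| <= `|a| /\ f (z + a *: v) - f z = a * 'D_v f (z + c *: v).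
Proof.
move=> df; pose h s := f (z + s *: v).
have dh (t : R) : `|t| <= `|a| -> is_derive t 1 h ('D_v f (z + t *: v)).
  by move=> /df; exact: is_derive_line.
have ch (I : interval R) : (forall t, t \in I -> `|t| <= `|a|) ->
    {within [set` I], continuous h}.
  move=> HI; apply: derivable_within_continuous => t /HI /dh dt.
  exact: ex_derive.
have h0 : h 0 = f z by rewrite /h scale0r addr0.
have [a0|a0|a0] := ltgtP a 0.
- have Ha t : t \in `[a, 0] -> `|t| <= `|a|.
    by rewrite in_itv /= => /andP[at0 t0]; rewrite (ler0_norm t0) (ltr0_norm a0) lerN2.
  have [|c cI] := @MVT R h (fun t => 'D_v f (z + t *: v)) a 0 a0 _ (ch _ Ha).
    by move=> t tI; apply: dh; apply: Ha; exact: subset_itv_oo_cc.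
  rewrite sub0r h0 => E; exists c; split; first by apply/Ha/subset_itv_oo_cc.
  by rewrite -/(h a) -opprB E; ring.
- have Ha t : t \in `[0, a] -> `|t| <= `|a|.
    by rewrite in_itv /= => /andP[t0 ta]; rewrite (ger0_norm t0) (gtr0_norm a0).
  have [|c cI] := @MVT R h (fun t => 'D_v f (z + t *: v)) 0 a a0 _ (ch _ Ha).
    by move=> t tI; apply: dh; apply: Ha; exact: subset_itv_oo_cc.
  rewrite subr0 h0 => E; exists c; split; first by apply/Ha/subset_itv_oo_cc.
  by rewrite -/(h a) E; ring.
- exists 0; rewrite a0 normr0 lexx; split=> //.
  by rewrite !scale0r addr0 subrr mul0r.
Qed.

(** Two nested mean value theorems: for the increment of [f] along [w], then for ['D_v f]. The
    left-hand side is symmetric under exchange of the two directions, and the symmetry of mixed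
    derivatives rests on this. *)
Lemma second_difference f z v w (s t : R) (B : set V) :
  (forall a b, `|a| <= `|s| -> `|b| <= `|t| -> B (z + a *: v + b *: w)) ->
  (forall y, B y -> derivable f y v) ->
  (forall y, B y -> derivable ('D_v f) y w) ->
  exists2 y, B y &
    f (z + s *: v + t *: w) - f (z + s *: v) - f (z + t *: w) + f z
    = s * t * 'D_w ('D_v f) y.
Proof.
move=> HB dv dvw.
have HB0 a : `|a| <= `|s| -> B (z + a *: v).
  move=> ha; have := HB a 0 ha; rewrite scale0r addr0 normr0; apply.
  exact: normr_ge0.
pose h y := f (y + t *: w) - f y.
have dh a : `|a| <= `|s| -> is_derive (z + a *: v) v h
    ('D_v f (z + a *: v + t *: w) - 'D_v f (z + a *: v)).
  move=> ha; apply: is_deriveB.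
    apply: DeriveDef.
      by have := dv _ (HB a t ha (lexx _)); rewrite /derivable /=;
        under eq_fun do rewrite addrA.
    by rewrite /derive /=; under eq_fun do rewrite -addrA.
  exact/derivableP/dv/HB0.
have [|c [hc E]] := @line_MVT h z v s.
  by move=> a ha; have [] := dh a ha.
have [|b [hb E2]] := @line_MVT ('D_v f) (z + c *: v) w t.
  by move=> b hb; apply/dvw/HB.
exists (z + c *: v + b *: w); first exact: HB.
move: E; have [_ ->] := dh c hc; rewrite E2 /h => E.
rewrite -mulrA -E; ring.
Qed.

Lemma derive_comm f U x v w : open U -> U x ->
  (forall y, U y -> derivable f y v) -> (forall y, U y -> derivable f y w) ->
  (forall y, U y -> derivable ('D_v f) y w) ->
  (forall y, U y -> derivable ('D_w f) y v) ->
  {for x, continuous ('D_w ('D_v f))} -> {for x, continuous ('D_v ('D_w f))} ->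
  'D_w ('D_v f) x = 'D_v ('D_w f) x.
Proof.
move=> oU Ux dv dw dvw dwv c1 c2.
apply/eqP; rewrite -subr_eq0 -normr_le0; apply/ler_addgt0Pr => e e0.
rewrite add0r.
have e2 : 0 < e / 2 by rewrite divr_gt0.
have U0 : nbhs x U by exact: open_nbhs_nbhs.
have [d /= d0 Hd] : exists2 d : R, 0 < d & ball x d `<=` [set y | [/\ U y,
    `|'D_w ('D_v f) x - 'D_w ('D_v f) y| < e / 2 &
    `|'D_v ('D_w f) x - 'D_v ('D_w f) y| < e / 2]].
  move/cvgrPdist_lt: c1 => /(_ _ e2) N1; move/cvgrPdist_lt: c2 => /(_ _ e2) N2.
  apply/nbhs_ballP; apply: filterS (filterI U0 (filterI N1 N2)).
  move=> y [Uy [y1 y2]]; split; [exact: Uy|exact: y1|exact: y2].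
(* With this [r] the parallelogram spanned by [r *: v] and [r *: w] stays in the ball of radius [d];
   the [+ 1] covers [v = w = 0]. *)
pose r := d / (`|v| + `|w| + 1).
have q0 : 0 < `|v| + `|w| + 1 by rewrite ltr_wpDl ?addr_ge0.
have r0 : 0 < r by rewrite divr_gt0.
have Hr a b : `|a| <= `|r| -> `|b| <= `|r| -> ball x d (x + a *: v + b *: w).
  rewrite (gtr0_norm r0) => ha hb.
  rewrite -ball_normE /= -addrA opprD addNKr normrN.
  apply: (le_lt_trans (ler_normD _ _)); rewrite !normrZ.
  apply: (@le_lt_trans _ _ (r * `|v| + r * `|w|)).
    by apply: lerD; exact: ler_wpM2r.
  rewrite -mulrDr /r mulrAC ltr_pdivrMr // ltr_pM2l // ltrDl //.
have [||y1 B1 E1] := @second_difference f x v w r r (ball x d) Hr.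
- by move=> y /Hd[Uy _ _]; exact: dv.
- by move=> y /Hd[Uy _ _]; exact: dvw.
have [|||y2 B2 E2] := @second_difference f x w v r r (ball x d).
- by move=> a b ha hb; rewrite addrAC; exact: Hr.
- by move=> y /Hd[Uy _ _]; exact: dw.
- by move=> y /Hd[Uy _ _]; exact: dwv.
(* Both values are the same second difference divided by [r * r]. *)
have E : 'D_w ('D_v f) y1 = 'D_v ('D_w f) y2.
  apply: (@mulfI _ (r * r)); first by rewrite mulf_neq0 ?gt_eqF.
  apply: etrans (esym E1) _; apply: etrans _ E2; rewrite (addrAC x (r *: v)).
  by move: (f (x + r *: v)) (f (x + r *: w)) => p q; rewrite (addrAC _ (- p)).
have [_ H1 _] := Hd _ B1; have [_ _ H2] := Hd _ B2.
rewrite distrC in H2.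
have -> : 'D_w ('D_v f) x - 'D_v ('D_w f) x =
  ('D_w ('D_v f) x - 'D_w ('D_v f) y1) + ('D_v ('D_w f) y2 - 'D_v ('D_w f) x).
  by rewrite E addrA subrK.
apply: (le_trans (ler_normD _ _)); rewrite (splitr e).
exact: (lerD (ltW H1) (ltW H2)).
Qed.

End LineCalculus.

Local Opaque derive.

Lemma linear_approx_differentiable (R : realType) (V W : normedModType R)
    (f : V -> W) (L : {linear V -> W}) x : continuous L ->
  (forall e, 0 < e -> \forall h \near (0 : V), `|f (h + x) - f x - L h| <= e * `|h|) ->
  differentiable f x.
Proof.
move=> cL HL.
suff H : f \o shift x = cst (f x) + L +o_ 0 id.
  by apply/diff_locallyP; rewrite (diff_unique cL H).
apply/eqaddoP => e e0; apply: filterS (HL e e0) => h /=.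
by rewrite opprD addrA.
Qed.

(** * Continuous partial derivatives imply Fréchet differentiability *)

Section C1Differentiable.
Variables (R : realType) (d : nat).
Implicit Types (f : 'rV[R]_d -> R) (x h : 'rV[R]_d) (U : set 'rV[R]_d).

Lemma row_normP h (e : R) : 0 <= e -> (forall j : 'I_d, `|h 0 j| <= e) -> `|h| <= e.
Proof.
move=> e0 H; rewrite /Num.Def.normr /= mx_normrE.
by apply: bigmax_le => // -[i j] _ /=; rewrite ord1.
Qed.

Lemma row_norm_coord h j : `|h 0 j| <= `|h|.
Proof.
rewrite [leRHS]/Num.Def.normr /= mx_normrE.
exact: (le_bigmax _ (fun ij => `|h ij.1 ij.2|) (0, j)).
Qed.

Lemma C1_differentiable f U x : open U -> U x ->
  (forall (j : 'I_d) y, U y -> derivable f y (delta_mx 0 j)) ->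
  (forall j : 'I_d, {for x, continuous ('D_(delta_mx 0 j) f)}) ->
  differentiable f x.
Proof.
move=> oU Ux df cf.
pose L h := \sum_j h 0 j * 'D_(delta_mx 0 j) f x.
have linL : linear (L : 'rV[R]_d -> R).
  move=> a u v; have -> : a *: L u = a * L u by [].
  rewrite /L mulr_sumr -big_split /=.
  by apply: eq_bigr => j _; rewrite !mxE mulrDl mulrA.
pose LM := GRing.isLinear.Build _ _ _ _ _ linL.
pose LL : {linear 'rV[R]_d -> R} := HB.pack (L : 'rV[R]_d -> R) LM.
have cL : continuous (LL : 'rV[R]_d -> R).
  apply: continuous_big => [|j _ y]; first exact: add_continuous.
  apply: (@differentiable_continuous R _ _ y (fun h : 'rV[R]_d => h 0 j * _)).
  apply: differentiableM; first exact: differentiable_coord.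
  exact: differentiable_cst.
apply: (linear_approx_differentiable cL) => e e_gt0.
pose e' := e / (d%:R + 1).
(* Each of the [d] coordinate moves below costs at most [e' * |h|]; the [+ 1] keeps the denominator
   positive for [d = 0]. *)
have d0 : 0 < d%:R + 1 :> R by rewrite ltr_wpDl.
have e'0 : 0 < e' by rewrite divr_gt0.
have [r /= r0 Hr] : exists2 r : R, 0 < r & ball x r `<=` [set y | U y /\
    forall j : 'I_d, `|'D_(delta_mx 0 j) f x - 'D_(delta_mx 0 j) f y| < e'].
  apply/nbhs_ballP.
  have N : \forall y \near x, forall j : 'I_d,
      `|'D_(delta_mx 0 j) f x - 'D_(delta_mx 0 j) f y| < e'.
    apply: (@filter_forall _ 'I_d (fun j y => `|'D_(delta_mx 0 j) f x -
      'D_(delta_mx 0 j) f y| < e') (nbhs x) (nbhs_filter x)) => j.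
    by have /cvgrPdist_lt := cf j; apply.
  have U0 : nbhs x U by exact: open_nbhs_nbhs.
  by apply: filterS (filterI U0 N).
apply/nbhs_ballP; exists r => //= h.
rewrite -ball_normE /= sub0r normrN => hr.
(* A staircase from [x] to [h + x]: the step from [z k] to [z k.+1] moves along one axis only, where
   the mean value theorem applies. *)
pose z (k : nat) := \row_j (x 0 j + if (j < k)%N then h 0 j else 0).
have z0 : z 0%N = x by apply/rowP => j; rewrite mxE addr0.
have zd : z d = h + x by apply/rowP => j; rewrite !mxE ltn_ord addrC.
have Hz (k : 'I_d) (c : R) : `|c| <= `|h 0 k| -> ball x r (z k + c *: delta_mx 0 k).
  move=> hc; rewrite -ball_normE /= distrC; apply: le_lt_trans hr.
  apply: row_normP => // j; rewrite !mxE eqxx /= eq_sym.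
  have [<-|jk] := eqVneq k j.
    rewrite ltnn mulr1 addr0 addrAC subrr add0r.
    by apply: le_trans hc _; exact: row_norm_coord.
  rewrite mulr0 addr0 addrAC subrr add0r.
  by case: ifP => _; [exact: row_norm_coord|rewrite normr0].
have zS (k : 'I_d) : z k.+1 = z k + h 0 k *: delta_mx 0 k.
  apply/rowP => j; rewrite !mxE eqxx /= -addrA; congr (_ + _).
  rewrite ltnS leq_eqVlt -val_eqE /= eq_sym.
  have [kj|kj] := eqVneq (k : nat) j.
    by rewrite -kj ltnn mulr1 add0r (val_inj kj).
  by rewrite mulr0 addr0.
have Hk (k : 'I_d) : `|f (z k.+1) - f (z k) - h 0 k * 'D_(delta_mx 0 k) f x|
    <= e' * `|h|.
  have [|c [hc E]] := @line_MVT R _ f (z k) (delta_mx 0 k) (h 0 k).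
    by move=> t ht; apply: df; have [] := Hr _ (Hz k t ht).
  rewrite zS E -mulrBr normrM mulrC.
  apply: ler_pM => //; last exact: row_norm_coord.
  by rewrite distrC; apply: ltW; have [_] := Hr _ (Hz k c hc); exact.
have -> : f (h + x) - f x - LL h =
    \sum_(k < d) (f (z k.+1) - f (z k) - h 0 k * 'D_(delta_mx 0 k) f x).
  rewrite sumrB -(big_mkord xpredT (fun k => f (z k.+1) - f (z k))).
  by rewrite telescope_sumr // z0 zd.
apply: (le_trans (ler_norm_sum _ _ _)).
apply: (@le_trans _ _ (\sum_(k < d) e' * `|h|)).
  by apply: ler_sum => k _; exact: Hk.
rewrite sumr_const card_ord -mulr_natr mulrAC ler_wpM2r //.
by rewrite /e' mulrAC ler_pdivrMr // ler_wpM2l ?lerDl // ltW.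
Qed.

End C1Differentiable.

(** * Smooth scalar functions and their closure properties *)

Section ScalarSmooth.
Variables (R : realType) (d : nat).
Implicit Types (f g : 'rV[R]_d -> R) (U : set 'rV[R]_d).

(** Unlike [Ck], the recursion asks for Fréchet differentiability and passes through every
    direction; in this form the product and chain rules can be iterated. *)
Fixpoint diffk (k : nat) U f : Prop :=
  if k is k'.+1 then
    (forall x, U x -> differentiable f x) /\ forall v, diffk k' U ('D_v f)
  else forall x, U x -> {for x, continuous f}.

Lemma diffkW k U f : diffk k.+1 U f -> diffk k U f.
Proof.
elim: k f => [|k IH] f [df Df]; first by move=> x /df; exact: differentiable_continuous.
by split=> // v; apply: IH.
Qed.

Lemma near_eq_open (T : Type) U (f g : 'rV[R]_d -> T) x : open U -> U x ->
  (forall x, U x -> f x = g x) -> \near x, f x = g x.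
Proof. by move=> oU Ux fg; apply: filterS fg _; exact: open_nbhs_nbhs. Qed.

Lemma derive_eq_open U f g v : open U -> (forall x, U x -> f x = g x) ->
  forall x, U x -> 'D_v f x = 'D_v g x.
Proof.
by move=> oU fg x Ux; apply: near_eq_derive; exact: near_eq_open fg.
Qed.

Lemma differentiable_eq_open U f g x : open U -> U x ->
  (forall x, U x -> f x = g x) -> differentiable f x -> differentiable g x.
Proof.
move=> oU Ux fg df; have cL := diff_continuous df.
apply: (linear_approx_differentiable cL) => e e0.
have /eqaddoP /(_ e e0) H := diff_locally df.
have N : \forall h \near (0 : 'rV[R]_d), f (h + x) = g (h + x).
  have : \near x, U x by exact: open_nbhs_nbhs.
  by rewrite (near_shift 0 x) subr0; apply: filterS => h /fg.
apply: filterS (filterI H N) => h [] /= H1 <-.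
by rewrite -(fg x Ux); move: H1; rewrite opprD addrA.
Qed.

Lemma diffk_eq k U f g : open U -> (forall x, U x -> f x = g x) ->
  diffk k U f -> diffk k U g.
Proof.
move=> oU; elim: k f g => [|k IH] f g fg.
  move=> cf x Ux; have : f @ x --> f x := cf x Ux.
  rewrite (fg x Ux) => H; apply: cvg_trans H.
  exact: (@near_eq_cvg _ _ (nbhs x) (nbhs_filter x) f g (near_eq_open oU Ux fg)).
move=> [df Df]; split=> [x Ux|v].
  exact: (differentiable_eq_open oU Ux fg (df x Ux)).
exact: IH (derive_eq_open v oU fg) (Df v).
Qed.

End ScalarSmooth.

Section ScalarSmoothClosure.
Variables (R : realType) (d : nat).
Implicit Types (f g : 'rV[R]_d -> R) (U : set 'rV[R]_d) (v x : 'rV[R]_d).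

Lemma D_cst (c : R) v x : 'D_v (fun=> c : R) x = 0.
Proof. exact: derive_cst. Qed.

Lemma D_add f g v x : differentiable f x -> differentiable g x ->
  'D_v (fun y => f y + g y) x = 'D_v f x + 'D_v g x.
Proof. by move=> df dg; apply: deriveD; exact: diff_derivable. Qed.

Lemma D_mul f g v x : differentiable f x -> differentiable g x ->
  'D_v (fun y => f y * g y) x = 'D_v f x * g x + f x * 'D_v g x.
Proof.
move=> df dg; rewrite [_ * g x]mulrC addrC.
by apply: (@deriveM R _ f g); exact: diff_derivable.
Qed.

Lemma D_inv f v x : differentiable f x -> f x != 0 ->
  'D_v (fun y => (f y)^-1) x = - ('D_v f x * ((f x)^-1 * (f x)^-1)).
Proof.
move=> df f0; rewrite (_ : 'D_v (fun y => (f y)^-1) x = - f x ^- 2 *: 'D_v f x).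
  by rewrite scaleNr -exprVn expr2 (mulrC ('D_v f x)).
by apply: (@deriveV R _ f); [|exact: diff_derivable].
Qed.

Lemma D_comb f v x : differentiable f x ->
  'D_v f x = \sum_j v 0 j * 'D_(delta_mx 0 j) f x.
Proof.
move=> df; rewrite deriveE // [v in LHS]row_sum_delta linear_sum.
by apply: eq_bigr => j _; rewrite linearZ deriveE.
Qed.

Lemma diffk_cst k U (c : R) : diffk k U (fun=> c).
Proof.
elim: k c => [|k IH] c; first by move=> x _; exact: cst_continuous.
split=> [x _|v]; first exact: differentiable_cst.
by rewrite (_ : 'D_v _ = fun=> 0) //; apply/funext => x; rewrite D_cst.
Qed.

Lemma diffkD k U f g : open U -> diffk k U f -> diffk k U g ->
  diffk k U (fun x => f x + g x).
Proof.
move=> oU; elim: k f g => [|k IH] f g.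
  by move=> cf cg x Ux; apply: (@continuousD R _ _ f g); [exact: cf|exact: cg].
move=> [df Df] [dg Dg]; split=> [x Ux|v].
  by apply: (@differentiableD R _ _ f g); [exact: df|exact: dg].
apply: diffk_eq oU _ (IH _ _ (Df v) (Dg v)) => x Ux.
by rewrite D_add; [|exact: df|exact: dg].
Qed.

Lemma diffkM k U f g : open U -> diffk k U f -> diffk k U g ->
  diffk k U (fun x => f x * g x).
Proof.
move=> oU; elim: k f g => [|k IH] f g.
  by move=> cf cg x Ux; apply: (@continuousM R _ f g); [exact: cf|exact: cg].
move=> /[dup] /diffkW kf [df Df] /[dup] /diffkW kg [dg Dg]; split=> [x Ux|v].
  by apply: (@differentiableM R _ f g); [exact: df|exact: dg].
apply: diffk_eq oU _ (diffkD oU (IH _ _ (Df v) kg) (IH _ _ kf (Dg v))) => x Ux.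
by rewrite D_mul; [|exact: df|exact: dg].
Qed.

Lemma diffkN k U f : open U -> diffk k U f -> diffk k U (fun x => - f x).
Proof.
move=> oU kf; apply: diffk_eq oU _ (diffkM oU (diffk_cst k U (-1)) kf) => x _.
by rewrite mulN1r.
Qed.

Lemma diffk_sum k U (I : Type) (r : seq I) (P : pred I) (F : I -> 'rV[R]_d -> R) :
  open U -> (forall i, diffk k U (F i)) ->
  diffk k U (fun x => \sum_(i <- r | P i) F i x).
Proof.
move=> oU kF; elim: r => [|i r IH].
  by apply: diffk_eq oU _ (diffk_cst k U 0) => x _; rewrite big_nil.
case Pi: (P i); last first.
  by apply: diffk_eq oU _ IH => x _; rewrite big_cons Pi.
by apply: diffk_eq oU _ (diffkD oU (kF i) IH) => x _; rewrite big_cons Pi.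
Qed.

Lemma diffk_prod k U (I : Type) (r : seq I) (P : pred I) (F : I -> 'rV[R]_d -> R) :
  open U -> (forall i, diffk k U (F i)) ->
  diffk k U (fun x => \prod_(i <- r | P i) F i x).
Proof.
move=> oU kF; elim: r => [|i r IH].
  by apply: diffk_eq oU _ (diffk_cst k U 1) => x _; rewrite big_nil.
case Pi: (P i); last first.
  by apply: diffk_eq oU _ IH => x _; rewrite big_cons Pi.
by apply: diffk_eq oU _ (diffkM oU (kF i) IH) => x _; rewrite big_cons Pi.
Qed.

Lemma diffkV k U f : open U -> (forall x, U x -> f x != 0) -> diffk k U f ->
  diffk k U (fun x => (f x)^-1).
Proof.
move=> oU f0; elim: k => [|k IH].
  move=> cf x Ux; apply: (@continuous_comp _ _ _ f (fun y : R => y^-1)).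
    exact: cf.
  by apply: inv_continuous; exact: f0.
move=> /[dup] /diffkW /IH kV [df Df]; split=> [x Ux|v].
  by apply: (@differentiableV R _ f); [exact: df|exact: f0].
apply: diffk_eq oU _ (diffkN oU (diffkM oU (Df v) (diffkM oU kV kV))) => x Ux.
by rewrite D_inv; [|exact: df|exact: f0].
Qed.

Lemma diffkS_partial k U f : open U ->
  (forall x, U x -> differentiable f x) ->
  (forall j : 'I_d, diffk k U ('D_(delta_mx 0 j) f)) -> diffk k.+1 U f.
Proof.
move=> oU df Df; split=> // v.
apply: diffk_eq oU _ (diffk_sum (index_enum 'I_d) xpredT oU
  (fun j : 'I_d => diffkM oU (diffk_cst k U (v 0 j)) (Df j))) => x Ux.
by rewrite D_comb //; exact: df.
Qed.

(** One order is lost because differentiability is deduced from the continuity of the first partial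
    derivatives. This is harmless for [smooth], which quantifies over all orders. *)
Lemma Ck_diffk k U f : open U -> Ck k.+1 U f -> diffk k U f.
Proof.
move=> oU; elim: k f => [|k IH] f; first by case.
move=> [_ H]; apply: diffkS_partial => // [x Ux|j]; last by apply: IH; case: (H j).
apply: (C1_differentiable oU Ux) => j.
  by move=> y Uy; case: (H j) => + _; exact.
by case: (H j) => _ [+ _]; exact.
Qed.

End ScalarSmoothClosure.

(** * Smooth matrix-valued maps *)

Section MatrixSmooth.
Variables (R : realType) (d : nat).
Implicit Types (f g : 'rV[R]_d -> R) (U : set 'rV[R]_d) (u v x : 'rV[R]_d).

Definition ssmooth U f : Prop := forall k, diffk k U f.

Definition msmooth (m n : nat) U (A : 'rV[R]_d -> 'M[R]_(m, n)) : Prop :=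
  forall i j, ssmooth U (fun x => A x i j).

Lemma differentiable_mxP (m n : nat) (A : 'rV[R]_d -> 'M[R]_(m, n)) x :
  differentiable A x <-> forall i j, differentiable (fun y => A y i j) x.
Proof.
split=> [dA i j|dA].
  by apply: (@differentiable_comp R _ _ _ A (fun N : 'M[R]_(m, n) => N i j : R));
    [|exact: differentiable_coord].
rewrite (_ : A = \sum_i \sum_j (fun y => A y i j *: delta_mx i j)).
  apply: differentiable_sum => i; apply: differentiable_sum => j.
  exact: differentiableZl.
apply/funext => y; rewrite fct_sumE [LHS]matrix_sum_delta.
by apply: eq_bigr => i _; rewrite fct_sumE.
Qed.

Lemma D_mxE (m n : nat) (A : 'rV[R]_d -> 'M[R]_(m, n)) x v i j :
  differentiable A x -> 'D_v A x i j = 'D_v (fun y => A y i j) x.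
Proof. by move=> dA; rewrite derive_mx ?mxE //; exact: diff_derivable. Qed.

Lemma D_sum (I : Type) (r : seq I) (P : pred I) (F : I -> 'rV[R]_d -> R) x v :
  (forall i, differentiable (F i) x) ->
  'D_v (fun y => \sum_(i <- r | P i) F i y) x = \sum_(i <- r | P i) 'D_v (F i) x
  /\ differentiable (fun y => \sum_(i <- r | P i) F i y) x.
Proof.
move=> dF; elim: r => [|i r [IH dIH]].
  rewrite big_nil (_ : (fun y => _) = fun=> 0); last first.
    by apply/funext => y; rewrite big_nil.
  by split; [exact: D_cst|exact: differentiable_cst].
rewrite big_cons; case Pi: (P i).
  rewrite (_ : (fun y => _) = fun y => F i y + \sum_(i <- r | P i) F i y).
    split; first by rewrite D_add // IH.
    exact: (@differentiableD R _ _ (F i)).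
  by apply/funext => y; rewrite big_cons Pi.
rewrite (_ : (fun y => _) = fun y => \sum_(i <- r | P i) F i y) //.
by apply/funext => y; rewrite big_cons Pi.
Qed.

Lemma differentiable_mulmx (m n p : nat) (A : 'rV[R]_d -> 'M[R]_(m, n))
    (B : 'rV[R]_d -> 'M[R]_(n, p)) x :
  differentiable A x -> differentiable B x ->
  differentiable (fun y => A y *m B y) x.
Proof.
move=> /differentiable_mxP dA /differentiable_mxP dB.
apply/differentiable_mxP => i j.
rewrite (_ : (fun y => _) = fun y => \sum_k A y i k * B y k j).
  apply: (D_sum _ _ 0 _).2 => k.
  exact: (@differentiableM R _ (fun y => A y i k) (fun y => B y k j)).
by apply/funext => y; rewrite mxE.
Qed.

Lemma D_mulmx (m n p : nat) (A : 'rV[R]_d -> 'M[R]_(m, n))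
    (B : 'rV[R]_d -> 'M[R]_(n, p)) x v :
  differentiable A x -> differentiable B x ->
  'D_v (fun y => A y *m B y) x = 'D_v A x *m B x + A x *m 'D_v B x.
Proof.
move=> dA dB; have dAB := differentiable_mulmx dA dB.
have /differentiable_mxP dA' := dA; have /differentiable_mxP dB' := dB.
apply/matrixP => i j; rewrite D_mxE //.
rewrite (_ : (fun y => _) = fun y => \sum_k A y i k * B y k j); last first.
  by apply/funext => y; rewrite mxE.
rewrite (D_sum _ _ _ _).1; last first.
  by move=> k; exact: (@differentiableM R _ (fun y => A y i k) (fun y => B y k j)).
rewrite !mxE -big_split; apply: eq_bigr => k _.
by rewrite D_mul // !D_mxE.
Qed.

Lemma D_scalemx (m n : nat) f (A : 'rV[R]_d -> 'M[R]_(m, n)) x v :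
  differentiable f x -> differentiable A x ->
  'D_v (fun y => f y *: A y) x = 'D_v f x *: A x + f x *: 'D_v A x.
Proof.
move=> df dA; have dfA : differentiable (fun y => f y *: A y) x.
  apply/differentiable_mxP => i j.
  rewrite (_ : (fun y => _) = fun y => f y * A y i j).
    apply: (@differentiableM R _ f (fun y => A y i j)) => //.
    by move/differentiable_mxP: dA; exact.
  by apply/funext => y; rewrite mxE.
apply/matrixP => i j; rewrite D_mxE //.
rewrite (_ : (fun y => _) = fun y => f y * A y i j); last first.
  by apply/funext => y; rewrite mxE.
rewrite D_mul //; first by rewrite !mxE D_mxE.
by move/differentiable_mxP: dA; exact.
Qed.

Lemma D_trmx (m n : nat) (A : 'rV[R]_d -> 'M[R]_(m, n)) x v :
  differentiable A x -> 'D_v (fun y => (A y)^T) x = ('D_v A x)^T.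
Proof.
move=> dA; have /differentiable_mxP dA' := dA.
have dAt : differentiable (fun y => (A y)^T) x.
  apply/differentiable_mxP => i j.
  rewrite (_ : (fun y => _) = fun y => A y j i) //.
  by apply/funext => y; rewrite mxE.
apply/matrixP => i j; rewrite D_mxE // mxE D_mxE //.
by congr ('D_v _ x); apply/funext => y; rewrite mxE.
Qed.

Lemma D_dir (W : normedModType R) (F : 'rV[R]_d -> W) x a u v :
  differentiable F x -> 'D_(a *: u + v) F x = a *: 'D_u F x + 'D_v F x.
Proof. by move=> dF; rewrite !deriveE // linearP. Qed.

Lemma D_comp (e : nat) (W : normedModType R) (F : 'rV[R]_d -> 'rV[R]_e)
    (G : 'rV[R]_e -> W) x v :
  differentiable F x -> differentiable G (F x) ->
  'D_v (fun y => G (F y)) x = 'D_('D_v F x) G (F x).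
Proof.
move=> dF dG; rewrite (deriveE _ dF) (deriveE _ dG).
by rewrite deriveE; [rewrite diff_comp|exact: differentiable_comp].
Qed.

Lemma ssmooth_differentiable U f x : ssmooth U f -> U x -> differentiable f x.
Proof. by move=> /(_ 1%N)[+ _]; exact. Qed.

Lemma msmooth_differentiable (m n : nat) U (A : 'rV[R]_d -> 'M[R]_(m, n)) x :
  msmooth U A -> U x -> differentiable A x.
Proof.
move=> sA Ux; apply/differentiable_mxP => i j.
exact: ssmooth_differentiable (sA i j) Ux.
Qed.

Lemma ssmooth_eq U f g : open U -> (forall x, U x -> f x = g x) ->
  ssmooth U f -> ssmooth U g.
Proof. by move=> oU fg sf k; exact: diffk_eq fg (sf k). Qed.

Lemma msmooth_eq (m n : nat) U (A B : 'rV[R]_d -> 'M[R]_(m, n)) : open U ->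
  (forall x, U x -> A x = B x) -> msmooth U A -> msmooth U B.
Proof. by move=> oU AB sA i j; apply: ssmooth_eq oU _ (sA i j) => x /AB ->. Qed.

Lemma ssmooth_D U f v : ssmooth U f -> ssmooth U ('D_v f).
Proof. by move=> sf k; have [_] := sf k.+1; exact. Qed.

Lemma msmooth_D (m n : nat) U (A : 'rV[R]_d -> 'M[R]_(m, n)) v : open U ->
  msmooth U A -> msmooth U ('D_v A).
Proof.
move=> oU sA i j; apply: ssmooth_eq oU _ (ssmooth_D v (sA i j)) => x Ux.
by rewrite D_mxE //; exact: msmooth_differentiable Ux.
Qed.

Lemma ssmooth_D_comm U f x u v : open U -> U x -> ssmooth U f ->
  'D_u ('D_v f) x = 'D_v ('D_u f) x.
Proof.
move=> oU Ux sf.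
have df w y : U y -> derivable f y w.
  by move=> Uy; apply/diff_derivable/(ssmooth_differentiable sf).
have dDf w z y : U y -> derivable ('D_w f) y z.
  by move=> Uy; apply/diff_derivable/(ssmooth_differentiable (ssmooth_D w sf)).
apply: (derive_comm oU Ux (df v) (df u) (dDf v u) (dDf u v)).
- exact: (differentiable_continuous
    (ssmooth_differentiable (ssmooth_D u (ssmooth_D v sf)) Ux)).
- exact: (differentiable_continuous
    (ssmooth_differentiable (ssmooth_D v (ssmooth_D u sf)) Ux)).
Qed.

Lemma msmooth_D_comm (m n : nat) U (A : 'rV[R]_d -> 'M[R]_(m, n)) x u v :
  open U -> U x -> msmooth U A -> 'D_u ('D_v A) x = 'D_v ('D_u A) x.
Proof.
move=> oU Ux sA; apply/matrixP => i j.
have dD w : differentiable ('D_w A) x.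
  exact: msmooth_differentiable (msmooth_D w oU sA) Ux.
have E w z : 'D_z (fun y => 'D_w A y i j) x = 'D_z ('D_w (fun y => A y i j)) x.
  apply: derive_eq_open oU _ _ Ux => y Uy; apply: D_mxE.
  exact: msmooth_differentiable Uy.
apply: etrans (etrans (D_mxE u i j (dD v)) (E v u)) _.
apply: etrans (ssmooth_D_comm u v oU Ux (sA i j)) _.
exact: (esym (etrans (D_mxE v i j (dD u)) (E u v))).
Qed.

Lemma msmooth_cst (m n : nat) U (A : 'M[R]_(m, n)) : msmooth U (fun=> A).
Proof. by move=> i j k; exact: diffk_cst. Qed.

Lemma msmooth_add (m n : nat) U (A B : 'rV[R]_d -> 'M[R]_(m, n)) : open U ->
  msmooth U A -> msmooth U B -> msmooth U (fun x => A x + B x).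
Proof.
move=> oU sA sB i j k; apply: diffk_eq oU _ (diffkD oU (sA i j k) (sB i j k)).
by move=> x _; rewrite mxE.
Qed.

Lemma msmooth_scale (m n : nat) U f (A : 'rV[R]_d -> 'M[R]_(m, n)) : open U ->
  ssmooth U f -> msmooth U A -> msmooth U (fun x => f x *: A x).
Proof.
move=> oU sf sA i j k; apply: diffk_eq oU _ (diffkM oU (sf k) (sA i j k)).
by move=> x _; rewrite mxE.
Qed.

Lemma msmooth_mul (m n p : nat) U (A : 'rV[R]_d -> 'M[R]_(m, n))
    (B : 'rV[R]_d -> 'M[R]_(n, p)) : open U ->
  msmooth U A -> msmooth U B -> msmooth U (fun x => A x *m B x).
Proof.
move=> oU sA sB i j k.
apply: diffk_eq oU _ (diffk_sum (index_enum 'I_n) xpredT oU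
  (fun l => diffkM oU (sA i l k) (sB l j k))).
by move=> x _; rewrite mxE.
Qed.

Lemma msmooth_tr (m n : nat) U (A : 'rV[R]_d -> 'M[R]_(m, n)) : open U ->
  msmooth U A -> msmooth U (fun x => (A x)^T).
Proof.
by move=> oU sA i j k; apply: diffk_eq oU _ (sA j i k) => x _; rewrite mxE.
Qed.

Lemma ssmooth_det (n : nat) U (A : 'rV[R]_d -> 'M[R]_n) : open U ->
  msmooth U A -> ssmooth U (fun x => \det (A x)).
Proof.
move=> oU sA k; rewrite /determinant; apply: diffk_sum => // s.
by apply: diffkM => //; [exact: diffk_cst|apply: diffk_prod => // i; exact: sA].
Qed.

(** Cramer's rule: an entry of the inverse is a cofactor over the determinant. *)
Lemma msmooth_inv (n : nat) U (A : 'rV[R]_d -> 'M[R]_n) : open U ->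
  (forall x, U x -> A x \in unitmx) -> msmooth U A ->
  msmooth U (fun x => invmx (A x)).
Proof.
move=> oU uA sA i j k.
apply: (@diffk_eq _ _ _ _ (fun x => (\det (A x))^-1 * cofactor (A x) j i)) => //.
  by move=> x Ux; rewrite /invmx uA // !mxE.
apply: diffkM => //; first apply: diffkV => //.
- by move=> x /uA; rewrite unitmxE unitfE.
- exact: ssmooth_det.
rewrite /cofactor; apply: diffkM => //; first exact: diffk_cst.
apply: (@ssmooth_det _ U (fun x => row' j (col' i (A x)))) => // a b l.
by apply: diffk_eq oU _ (sA (lift j a) (lift i b) l) => x _; rewrite !mxE.
Qed.

Lemma msmooth_id U : open U -> msmooth U (fun x : 'rV[R]_d => x).
Proof.
move=> oU i j k; rewrite ord1 {i}.
have D0 v x : 'D_v (fun y : 'rV[R]_d => y 0 j) x = v 0 j.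
  have := @D_mxE 1 d id x v 0 j _; rewrite derive_id => <- //.
case: k => [|k].
  by move=> x _; apply: differentiable_continuous; exact: differentiable_coord.
split=> [x _|v]; first exact: differentiable_coord.
by apply: diffk_eq oU _ (diffk_cst k U (v 0 j)) => x _; rewrite D0.
Qed.

End MatrixSmooth.

(** Induction on the order for all [f] at once: by the chain rule, a derivative of the composite is
    a sum of products of components of ['D_v F] with composites of partial derivatives of [f]. *)
Lemma ssmooth_comp (R : realType) (d e : nat) (U : set 'rV[R]_d)
    (W : set 'rV[R]_e) (F : 'rV[R]_d -> 'rV[R]_e) (f : 'rV[R]_e -> R) :
  open U -> (forall x, U x -> W (F x)) -> msmooth U F -> ssmooth W f ->
  ssmooth U (fun x => f (F x)).
Proof.
move=> oU FW sF sf k; elim: k f sf => [|k IH] f sf.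
  move=> x Ux; apply: (@continuous_comp _ _ _ F f).
    by apply: differentiable_continuous; exact: msmooth_differentiable Ux.
  by apply: differentiable_continuous; exact: ssmooth_differentiable (FW _ Ux).
have dF x (Ux : U x) := msmooth_differentiable sF Ux.
have df x (Ux : U x) := ssmooth_differentiable sf (FW x Ux).
split=> [x Ux|v].
  by apply: (@differentiable_comp R _ _ _ F f); [exact: dF|exact: df].
apply: diffk_eq oU _ (diffk_sum (index_enum 'I_e) xpredT oU (fun j =>
  diffkM oU (msmooth_D v oU sF 0 j k) (IH _ (ssmooth_D (delta_mx 0 j) sf)))).
by move=> x Ux; rewrite (D_comp _ (dF x Ux) (df x Ux)) (D_comb _ (df x Ux)).
Qed.

Lemma msmooth_comp (R : realType) (d e m n : nat) (U : set 'rV[R]_d)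
    (W : set 'rV[R]_e) (F : 'rV[R]_d -> 'rV[R]_e) (A : 'rV[R]_e -> 'M[R]_(m, n)) :
  open U -> (forall x, U x -> W (F x)) -> msmooth U F -> msmooth W A ->
  msmooth U (fun x => A (F x)).
Proof.
move=> oU FW sF sA i j.
exact: (@ssmooth_comp _ _ _ U W F (fun y => A y i j)).
Qed.

Section SealedDerivative.
Variables (R : realType) (d : nat).

(* An opaque copy of the directional derivative: comparing two instances of
   ['D_v f x] up to conversion may unfold limits and diverge. *)
Lemma dd_subproof (W : normedModType R) :
  {D : 'rV[R]_d -> ('rV[R]_d -> W) -> 'rV[R]_d -> W | forall v f x, D v f x = 'D_v f x}.
Proof. by exists (fun v f x => 'D_v f x). Qed.

Definition dd (W : normedModType R) v (f : 'rV[R]_d -> W) x : W :=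
  sval (dd_subproof W) v f x.

Lemma ddE (W : normedModType R) v (f : 'rV[R]_d -> W) x : 'D_v f x = dd v f x.
Proof. by rewrite /dd; case: (dd_subproof W) => D /= ->. Qed.

Lemma ddF (W : normedModType R) v (f : 'rV[R]_d -> W) : 'D_v f = dd v f.
Proof. by apply/funext => x; exact: ddE. Qed.

Lemma dd_eq (W : normedModType R) (U : set 'rV[R]_d) (f g : 'rV[R]_d -> W) v x :
  open U -> U x -> (forall x, U x -> f x = g x) -> dd v f x = dd v g x.
Proof.
by move=> oU Ux fg; rewrite -!ddE; apply: near_eq_derive; exact: near_eq_open fg.
Qed.

Lemma dd_dir (W : normedModType R) (F : 'rV[R]_d -> W) x a u v :
  differentiable F x -> dd (a *: u + v) F x = a *: dd u F x + dd v F x.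
Proof. by move=> dF; rewrite -!ddE; exact: D_dir. Qed.

Lemma dd_cst (W : normedModType R) (c : W) v x : dd v (fun=> c) x = 0.
Proof. by rewrite -ddE; exact: derive_cst. Qed.

Lemma dd_id v x : dd v (fun y => y) x = v.
Proof. by rewrite -ddE; exact: derive_id. Qed.

Lemma dd_mul (f g : 'rV[R]_d -> R) v x : differentiable f x -> differentiable g x ->
  dd v (fun y => f y * g y) x = dd v f x * g x + f x * dd v g x.
Proof. by move=> df dg; rewrite -!ddE; exact: D_mul. Qed.

Lemma dd_mulmx (m n p : nat) (A : 'rV[R]_d -> 'M[R]_(m, n))
    (B : 'rV[R]_d -> 'M[R]_(n, p)) x v :
  differentiable A x -> differentiable B x ->
  dd v (fun y => A y *m B y) x = dd v A x *m B x + A x *m dd v B x.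
Proof. by move=> dA dB; rewrite -!ddE; exact: D_mulmx. Qed.

Lemma dd_add (W : normedModType R) (A B : 'rV[R]_d -> W) x v :
  differentiable A x -> differentiable B x ->
  dd v (fun y => A y + B y) x = dd v A x + dd v B x.
Proof.
by move=> dA dB; rewrite -!ddE; apply: deriveD; exact: diff_derivable.
Qed.

Lemma dd_scalemx (m n : nat) (f : 'rV[R]_d -> R) (A : 'rV[R]_d -> 'M[R]_(m, n)) x v :
  differentiable f x -> differentiable A x ->
  dd v (fun y => f y *: A y) x = dd v f x *: A x + f x *: dd v A x.
Proof. by move=> df dA; rewrite -!ddE; exact: D_scalemx. Qed.

Lemma dd_trmx (m n : nat) (A : 'rV[R]_d -> 'M[R]_(m, n)) x v :
  differentiable A x -> dd v (fun y => (A y)^T) x = (dd v A x)^T.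
Proof. by move=> dA; rewrite -!ddE; exact: D_trmx. Qed.

Lemma dd_mxE (m n : nat) (A : 'rV[R]_d -> 'M[R]_(m, n)) x v i j :
  differentiable A x -> dd v A x i j = dd v (fun y => A y i j) x.
Proof. by move=> dA; rewrite -!ddE; exact: D_mxE. Qed.

Lemma dd_comm (m n : nat) U (A : 'rV[R]_d -> 'M[R]_(m, n)) x u v :
  open U -> U x -> msmooth U A -> dd u (dd v A) x = dd v (dd u A) x.
Proof.
by move=> oU Ux sA; rewrite -!ddF; exact: msmooth_D_comm Ux sA.
Qed.

Lemma dd_comm_scalar U (f : 'rV[R]_d -> R) x u v :
  open U -> U x -> ssmooth U f -> dd u (dd v f) x = dd v (dd u f) x.
Proof.
by move=> oU Ux sf; rewrite -!ddF; exact: ssmooth_D_comm Ux sf.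
Qed.

Lemma msmooth_dd (m n : nat) U (A : 'rV[R]_d -> 'M[R]_(m, n)) v : open U ->
  msmooth U A -> msmooth U (dd v A).
Proof. by move=> oU sA; rewrite -ddF; exact: msmooth_D. Qed.

End SealedDerivative.

Lemma dd_comp (R : realType) (d e : nat) (W : normedModType R)
    (F : 'rV[R]_e -> 'rV[R]_d) (G : 'rV[R]_d -> W) x v :
  differentiable F x -> differentiable G (F x) ->
  dd v (fun y => G (F y)) x = dd (dd v F x) G (F x).
Proof. by move=> dF dG; rewrite -!ddE; exact: D_comp. Qed.

(** * Bilinear forms and their derivatives *)

Section Inner.
Variables (R : realType) (d : nat).
Implicit Types (G : 'M[R]_d) (u v w : 'rV[R]_d).

Lemma innerDl G u v w : inner G (u + v) w = inner G u w + inner G v w.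
Proof. by rewrite /inner !mulmxDl mxE. Qed.

Lemma innerDr G u v w : inner G u (v + w) = inner G u v + inner G u w.
Proof. by rewrite /inner linearD /= mulmxDr mxE. Qed.

Lemma innerZl G a u w : inner G (a *: u) w = a * inner G u w.
Proof. by rewrite /inner -!scalemxAl mxE. Qed.

Lemma innerZr G a u w : inner G u (a *: w) = a * inner G u w.
Proof. by rewrite /inner linearZ /= -scalemxAr mxE. Qed.

Lemma innerNl G u w : inner G (- u) w = - inner G u w.
Proof. by rewrite -scaleN1r innerZl mulN1r. Qed.

Lemma innerNr G u w : inner G u (- w) = - inner G u w.
Proof. by rewrite -scaleN1r innerZr mulN1r. Qed.

Lemma innerBl G u v w : inner G (u - v) w = inner G u w - inner G v w.
Proof. by rewrite innerDl innerNl. Qed.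

Lemma inner0l G w : inner G 0 w = 0.
Proof. by rewrite /inner !mul0mx mxE. Qed.

Lemma inner0r G w : inner G w 0 = 0.
Proof. by rewrite /inner linear0 mulmx0 mxE. Qed.

Lemma inner_suml G (I : Type) (r : seq I) (P : pred I) (F : I -> 'rV[R]_d) w :
  inner G (\sum_(i <- r | P i) F i) w = \sum_(i <- r | P i) inner G (F i) w.
Proof.
by apply: (big_morph (inner G ^~ w)) => [u v|]; [exact: innerDl|exact: inner0l].
Qed.

Lemma inner_sumr G (I : Type) (r : seq I) (P : pred I) (F : I -> 'rV[R]_d) w :
  inner G w (\sum_(i <- r | P i) F i) = \sum_(i <- r | P i) inner G w (F i).
Proof.
by apply: (big_morph (inner G w)) => [u v|]; [exact: innerDr|exact: inner0r].
Qed.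

Lemma innerC G u v : G^T = G -> inner G u v = inner G v u.
Proof.
move=> sG; rewrite /inner.
have -> : u *m G *m v^T = (v *m G *m u^T)^T.
  by rewrite !trmx_mul trmxK sG mulmxA.
by rewrite mxE.
Qed.

(** This is how identities for the Christoffel map are proved: the Koszul formula gives its inner
    products rather than its components. *)
Lemma inner_nondeg G u v : G \in unitmx ->
  (forall w, inner G u w = inner G v w) -> u = v.
Proof.
move=> uG H; rewrite -[u](mulmxK uG) -[v](mulmxK uG); congr (_ *m _).
apply/rowP => j; have := H (delta_mx 0 j).
by rewrite /inner trmx_delta -!colE !mxE.
Qed.

Lemma dd_inner (n : nat) (G : 'rV[R]_n -> 'M[R]_d) (A B : 'rV[R]_n -> 'rV[R]_d)
    (u x : 'rV[R]_n) :
  differentiable G x -> differentiable A x -> differentiable B x ->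
  dd u (fun y => inner (G y) (A y) (B y)) x =
    inner (dd u G x) (A x) (B x) + inner (G x) (dd u A x) (B x)
    + inner (G x) (A x) (dd u B x).
Proof.
move=> dG dA dB.
have dAG := differentiable_mulmx dA dG.
have dBt : differentiable (fun y => (B y)^T) x.
  apply/differentiable_mxP => i j; rewrite (_ : (fun y => _) = fun y => B y j i).
    by move/differentiable_mxP: dB; exact.
  by apply/funext => y; rewrite mxE.
rewrite /inner -(dd_mxE _ _ _ (differentiable_mulmx dAG dBt)).
rewrite dd_mulmx // dd_mulmx // dd_trmx // mulmxDl !mxE -!addrA addrCA.
by rewrite !addrA -addrA addrC -addrA.
Qed.

Lemma ssmooth_inner (n : nat) (U : set 'rV[R]_n) (G : 'rV[R]_n -> 'M[R]_d)
    (A B : 'rV[R]_n -> 'rV[R]_d) : open U ->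
  msmooth U G -> msmooth U A -> msmooth U B ->
  ssmooth U (fun y => inner (G y) (A y) (B y)).
Proof.
move=> oU sG sA sB.
exact: msmooth_mul oU (msmooth_mul oU sA sG) (msmooth_tr oU sB) 0 0.
Qed.

End Inner.

(** * The Levi-Civita connection *)

Section InnerForm.
Variables (R : realType) (d : nat).
Implicit Types (G H : 'M[R]_d) (u v w : 'rV[R]_d).

Lemma innerDf G H u v : inner (G + H) u v = inner G u v + inner H u v.
Proof. by rewrite /inner mulmxDr mulmxDl mxE. Qed.

Lemma innerZf a G u v : inner (a *: G) u v = a * inner G u v.
Proof. by rewrite /inner -scalemxAr -scalemxAl mxE. Qed.

Lemma inner0f u v : inner 0 u v = 0.
Proof. by rewrite /inner mulmx0 mul0mx mxE. Qed.

Lemma inner_sumf (I : Type) (r : seq I) (P : pred I) (F : I -> 'M[R]_d) u v :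
  inner (\sum_(i <- r | P i) F i) u v = \sum_(i <- r | P i) inner (F i) u v.
Proof.
by apply: (big_morph (fun G => inner G u v)) => [G H|]; [exact: innerDf|exact: inner0f].
Qed.

Lemma dd_dir_comb (W : normedModType R) (F : 'rV[R]_d -> W) x v :
  differentiable F x -> dd v F x = \sum_j v 0 j *: dd (delta_mx 0 j) F x.
Proof.
move=> dF; rewrite -ddE deriveE // [v in LHS]row_sum_delta linear_sum.
by apply: eq_bigr => j _; rewrite linearZ -ddE deriveE.
Qed.

Lemma dd_inner_cst (g : 'rV[R]_d -> 'M[R]_d) (a u v y : 'rV[R]_d) :
  differentiable g y -> dd a (fun z => inner (g z) u v) y = inner (dd a g y) u v.
Proof.
move=> dg; rewrite dd_inner //; try exact: differentiable_cst.
by rewrite !dd_cst inner0l inner0r !addr0.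
Qed.

End InnerForm.

(** What the Koszul formula uses: symmetry and invertibility. Positivity is carried by separate
    hypotheses. *)
Definition metric_on (R : realType) (d : nat) (W : set 'rV[R]_d)
    (g : 'rV[R]_d -> 'M[R]_d) : Prop :=
  [/\ open W, msmooth W g, forall y, W y -> (g y)^T = g y &
      forall y, W y -> g y \in unitmx].

Section Christoffel.
Variables (R : realType) (d : nat).
Implicit Types (a b c y : 'rV[R]_d).

(** An opaque copy of [christoffel], whose body contains directional derivatives that conversion
    should not unfold. *)
Lemma Gam_subproof :
  {G : ('rV[R]_d -> 'M[R]_d) -> 'rV[R]_d -> 'rV[R]_d -> 'rV[R]_d -> 'rV[R]_d |
    forall g y a b, G g y a b = christoffel g y a b}.
Proof. by exists (@christoffel R d). Qed.

Definition Gam g y a b : 'rV[R]_d := sval Gam_subproof g y a b.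

Lemma GamE g y a b : christoffel g y a b = Gam g y a b.
Proof. by rewrite /Gam; case: Gam_subproof => G /= ->. Qed.

Variables (W : set 'rV[R]_d) (g : 'rV[R]_d -> 'M[R]_d).
Hypothesis gW : metric_on W g.

Let oW : open W. Proof. by case: gW. Qed.
Let sg : msmooth W g. Proof. by case: gW. Qed.
Let symg y : W y -> (g y)^T = g y. Proof. by case: gW => _ _ + _; exact. Qed.
Let ug y : W y -> g y \in unitmx. Proof. by case: gW => _ _ _; exact. Qed.

Let dg y (Wy : W y) : differentiable g y := msmooth_differentiable sg Wy.

Lemma dd_metric_sym a y : W y -> (dd a g y)^T = dd a g y.
Proof.
by move=> Wy; rewrite -dd_trmx; [apply: dd_eq oW Wy symg|exact: dg].
Qed.

(** The Koszul formula on constant fields, whose brackets vanish; pairing with [g y] cancels the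
    inverse matrix in [christoffel]. *)
Lemma Gam_lower y a b c : W y -> inner (g y) (Gam g y a b) c =
  2^-1 * (inner (dd a g y) b c + inner (dd b g y) a c - inner (dd c g y) a b).
Proof.
move=> Wy; rewrite -GamE /christoffel /inner mulmxKV ?ug // mxE.
have Dl u v w : 'D_u (fun z => inner (g z) v w) y = inner (dd u g y) v w.
  by rewrite ddE dd_inner_cst //; exact: dg.
under eq_bigr do rewrite !mxE !Dl.
have Ec G v : inner G v c = \sum_j c 0 j * inner G v (delta_mx 0 j).
  rewrite [in LHS](row_sum_delta c) inner_sumr.
  by apply: eq_bigr => j _; rewrite innerZr.
rewrite -![(_ *m _ *m c^T) 0 0]/(inner _ _ _) !Ec -/(inner _ _ _).
rewrite (dd_dir_comb c (dg Wy)) inner_sumf.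
rewrite -sumrN -!big_split mulr_sumr; apply: eq_bigr => j _ /=.
rewrite innerZf; ring.
Qed.

Lemma Gam_sym y a b : W y -> Gam g y a b = Gam g y b a.
Proof.
move=> Wy; apply: (inner_nondeg (ug Wy)) => c; rewrite !Gam_lower //.
by rewrite (innerC a b (dd_metric_sym c Wy)) [inner _ b c + _]addrC.
Qed.

Lemma Gam_linear_l y k a a' b : W y ->
  Gam g y (k *: a + a') b = k *: Gam g y a b + Gam g y a' b.
Proof.
move=> Wy; apply: (inner_nondeg (ug Wy)) => c; rewrite innerDl innerZl !Gam_lower //.
rewrite (dd_dir _ _ _ (dg Wy)) innerDf innerZf !innerDl !innerZl; ring.
Qed.

Lemma Gam_linear_r y k a b b' : W y ->
  Gam g y a (k *: b + b') = k *: Gam g y a b + Gam g y a b'.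
Proof. by move=> Wy; rewrite Gam_sym // Gam_linear_l // !(Gam_sym a). Qed.

(** In the sum of the two Koszul expressions the derivatives of [g] along [b] and [c] cancel. *)
Lemma Gam_compat y a b c : W y ->
  inner (g y) (Gam g y a b) c + inner (g y) b (Gam g y a c) = inner (dd a g y) b c.
Proof.
move=> Wy; rewrite (innerC b) ?symg // !Gam_lower //.
rewrite (innerC c b (dd_metric_sym a Wy)) -mulrDr.
set p := inner _ b c; set q := inner _ a c; set r := inner _ a b.
by field.
Qed.

Lemma Gam_Dl y a a' b : W y -> Gam g y (a + a') b = Gam g y a b + Gam g y a' b.
Proof. by move=> Wy; have := Gam_linear_l 1 a a' b Wy; rewrite !scale1r. Qed.

Lemma Gam_Dr y a b b' : W y -> Gam g y a (b + b') = Gam g y a b + Gam g y a b'.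
Proof. by move=> Wy; have := Gam_linear_r 1 a b b' Wy; rewrite !scale1r. Qed.

Lemma Gam_0l y b : W y -> Gam g y 0 b = 0.
Proof. by move=> Wy; apply: (addrI (Gam g y 0 b)); rewrite -Gam_Dl // !addr0. Qed.

Lemma Gam_0r y a : W y -> Gam g y a 0 = 0.
Proof. by move=> Wy; rewrite Gam_sym // Gam_0l. Qed.

Lemma Gam_Zl y k a b : W y -> Gam g y (k *: a) b = k *: Gam g y a b.
Proof.
by move=> Wy; have := Gam_linear_l k a 0 b Wy; rewrite !addr0 Gam_0l // addr0.
Qed.

Lemma Gam_Zr y k a b : W y -> Gam g y a (k *: b) = k *: Gam g y a b.
Proof. by move=> Wy; rewrite Gam_sym // Gam_Zl // Gam_sym. Qed.

Lemma Gam_suml y (I : Type) (r : seq I) (P : pred I) (F : I -> 'rV[R]_d) b : W y ->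
  Gam g y (\sum_(i <- r | P i) F i) b = \sum_(i <- r | P i) Gam g y (F i) b.
Proof.
move=> Wy; apply: (big_morph (Gam g y ^~ b)) => [u v|]; first exact: Gam_Dl.
exact: Gam_0l.
Qed.

Lemma Gam_sumr y (I : Type) (r : seq I) (P : pred I) (F : I -> 'rV[R]_d) a : W y ->
  Gam g y a (\sum_(i <- r | P i) F i) = \sum_(i <- r | P i) Gam g y a (F i).
Proof.
move=> Wy; apply: (big_morph (Gam g y a)) => [u v|]; first exact: Gam_Dr.
exact: Gam_0r.
Qed.

(** Each component of the Christoffel map becomes the matrix of a bilinear form, so that
    [ssmooth_inner] and [dd_inner] apply when both arguments vary with the point. *)
Definition Gam_coord (k : 'I_d) y : 'M[R]_d :=
  \matrix_(i, j) Gam g y (delta_mx 0 i) (delta_mx 0 j) 0 k.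

Lemma Gam_coordE k y a b : W y -> Gam g y a b 0 k = inner (Gam_coord k y) a b.
Proof.
move=> Wy.
have -> : Gam g y a b = \sum_j \sum_i
    (a 0 i * b 0 j) *: Gam g y (delta_mx 0 i) (delta_mx 0 j).
  rewrite [in LHS](row_sum_delta b) Gam_sumr //; apply: eq_bigr => j _.
  rewrite [in LHS](row_sum_delta a) Gam_suml //; apply: eq_bigr => i _.
  by rewrite Gam_Zl // Gam_Zr // scalerA.
rewrite /inner mxE summxE; apply: eq_bigr => j _.
rewrite summxE mxE mulr_suml; apply: eq_bigr => i _.
by rewrite !mxE; ring.
Qed.

Lemma msmooth_Gam_cst a b : msmooth W (fun y => Gam g y a b).
Proof.
apply: (@msmooth_eq _ _ _ _ W (fun y => christoffel g y a b)) => //.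
  by move=> y _; exact: GamE.
apply: msmooth_mul => //; last exact: msmooth_inv.
have Di u v w : ssmooth W ('D_u (fun z => inner (g z) v w)).
  by apply: ssmooth_D; apply: ssmooth_inner => //; exact: msmooth_cst.
move=> i j k; apply: (@diffk_eq _ _ k W (fun y => 2^-1 *
  ('D_a (fun z => inner (g z) b (delta_mx 0 j)) y +
   'D_b (fun z => inner (g z) a (delta_mx 0 j)) y -
   'D_(delta_mx 0 j) (fun z => inner (g z) a b) y))) => //.
  by move=> y _; rewrite mxE.
apply: diffkM => //; first exact: diffk_cst.
apply: diffkD => //; last by apply: diffkN => //; exact: Di.
by apply: diffkD => //; exact: Di.
Qed.

Lemma msmooth_Gam_coord k : msmooth W (Gam_coord k).
Proof.
move=> i j; apply: ssmooth_eq oW _ (msmooth_Gam_cst (delta_mx 0 i) (delta_mx 0 j) 0 k).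
by move=> y _; rewrite mxE.
Qed.

End Christoffel.

Definition smooth_map (R : realType) (n d : nat) (U : set 'rV[R]_n)
    (W : set 'rV[R]_d) (F : 'rV[R]_n -> 'rV[R]_d) : Prop :=
  [/\ open U, msmooth U F & forall x, U x -> W (F x)].

(** * The connection pulled back along a map *)

Section CovariantAlongMap.
Variables (R : realType) (n d : nat).
Variables (W : set 'rV[R]_d) (g : 'rV[R]_d -> 'M[R]_d).
Hypothesis gW : metric_on W g.
Variables (U : set 'rV[R]_n) (F : 'rV[R]_n -> 'rV[R]_d).
Hypothesis FUW : smooth_map U W F.
Implicit Types (A B V : 'rV[R]_n -> 'rV[R]_d) (u v w x : 'rV[R]_n).

(** The pulled-back connection, on fields [V] along [F] that need not be restrictions of fields on
    the target. *)
Definition cov u V x : 'rV[R]_d := dd u V x + Gam g (F x) (dd u F x) (V x).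

(** The coordinate formula for the curvature [R(a,b)c]: derivatives of the Christoffel map plus its
    quadratic terms. *)
Definition riem (y a b c : 'rV[R]_d) : 'rV[R]_d :=
  dd a (fun z => Gam g z b c) y + Gam g y a (Gam g y b c)
  - (dd b (fun z => Gam g z a c) y + Gam g y b (Gam g y a c)).

Let oW : open W. Proof. by case: gW. Qed.
Let sg : msmooth W g. Proof. by case: gW. Qed.
Let oU : open U. Proof. by case: FUW. Qed.
Let sF : msmooth U F. Proof. by case: FUW. Qed.
Let FW x : U x -> W (F x). Proof. by case: FUW => _ _; exact. Qed.

Let dm (p q : nat) (A : 'rV[R]_n -> 'M[R]_(p, q)) x : msmooth U A -> U x ->
  differentiable A x.
Proof. by move=> sA; exact: msmooth_differentiable. Qed.

Lemma msmooth_Gam A B : msmooth U A -> msmooth U B ->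
  msmooth U (fun x => Gam g (F x) (A x) (B x)).
Proof.
move=> sA sB i k; rewrite ord1 {i}.
apply: (@ssmooth_eq _ _ _ (fun x => inner (Gam_coord g k (F x)) (A x) (B x))) => //.
  by move=> x Ux; rewrite (Gam_coordE gW) //; exact: FW.
apply: ssmooth_inner => //; apply: (msmooth_comp oU FW) => //.
exact: msmooth_Gam_coord.
Qed.

Lemma dd_Gam A B u x : msmooth U A -> msmooth U B -> U x ->
  dd u (fun x => Gam g (F x) (A x) (B x)) x =
    dd (dd u F x) (fun z => Gam g z (A x) (B x)) (F x)
    + Gam g (F x) (dd u A x) (B x) + Gam g (F x) (A x) (dd u B x).
Proof.
move=> sA sB Ux; have Wx := FW Ux.
have dF := dm sF Ux; have dA := dm sA Ux; have dB := dm sB Ux.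
have dN k := msmooth_differentiable (msmooth_Gam_coord gW k) Wx.
apply/rowP => k; rewrite dd_mxE; last exact: dm (msmooth_Gam sA sB) Ux.
rewrite (@dd_eq _ _ _ U _ (fun x => inner (Gam_coord g k (F x)) (A x) (B x))) //;
  last by move=> z Uz; rewrite (Gam_coordE gW) //; exact: FW.
rewrite dd_inner //; last exact: (@differentiable_comp R _ _ _ F (Gam_coord g k)).
rewrite (dd_comp _ dF (dN k)) !mxE !(Gam_coordE gW) //.
congr (_ + _ + _); rewrite dd_mxE; last first.
  exact: msmooth_differentiable (msmooth_Gam_cst gW _ _) Wx.
rewrite -dd_inner_cst //; apply: (dd_eq _ oW Wx) => z Wz.
by rewrite (Gam_coordE gW).
Qed.

Lemma msmooth_cov u V : msmooth U V -> msmooth U (cov u V).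
Proof.
move=> sV; apply: msmooth_add => //; first exact: msmooth_dd.
by apply: msmooth_Gam => //; exact: msmooth_dd.
Qed.

Lemma cov_metric A B u x : msmooth U A -> msmooth U B -> U x ->
  dd u (fun y => inner (g (F y)) (A y) (B y)) x =
    inner (g (F x)) (cov u A x) (B x) + inner (g (F x)) (A x) (cov u B x).
Proof.
move=> sA sB Ux; have Wx := FW Ux.
have dF := dm sF Ux; have dA := dm sA Ux; have dB := dm sB Ux.
have dgF := msmooth_differentiable sg Wx.
rewrite dd_inner //; last exact: (@differentiable_comp R _ _ _ F g).
rewrite (dd_comp _ dF dgF) -(Gam_compat gW _ _ _ Wx).
rewrite /cov innerDl innerDr; ring.
Qed.

Lemma cov_torsion u v x : U x -> cov u (dd v F) x = cov v (dd u F) x.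
Proof.
move=> Ux; rewrite /cov (dd_comm u v oU Ux sF); congr (_ + _).
exact: (Gam_sym gW _ _ (FW Ux)).
Qed.

(** The second derivatives of [V] and of [F] commute, so the difference keeps only the derivatives
    of the Christoffel map along [F] and its quadratic terms: the curvature is pulled back too. *)
Lemma cov_cov V u v x : msmooth U V -> U x ->
  cov u (cov v V) x - cov v (cov u V) x
  = riem (F x) (dd u F x) (dd v F x) (V x).
Proof.
move=> sV Ux; have Wx := FW Ux.
have GD := Gam_Dr gW _ _ _ Wx.
have E p q : cov p (cov q V) x = dd p (dd q V) x
   + (dd (dd p F x) (fun z => Gam g z (dd q F x) (V x)) (F x)
      + Gam g (F x) (dd p (dd q F) x) (V x) + Gam g (F x) (dd q F x) (dd p V x))
   + (Gam g (F x) (dd p F x) (dd q V x)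
      + Gam g (F x) (dd p F x) (Gam g (F x) (dd q F x) (V x))).
  rewrite {1}/cov {2}/cov GD dd_add.
  - by rewrite dd_Gam //; exact: msmooth_dd.
  - by apply: dm Ux; exact: msmooth_dd.
  - by apply: dm Ux; apply: msmooth_Gam => //; exact: msmooth_dd.
rewrite !E (dd_comm u v oU Ux sV) (dd_comm u v oU Ux sF) /riem.
set t1 := dd v _ x; set t2 := Gam _ _ (dd v (dd u F) x) _.
apply/rowP => k; rewrite !mxE; ring.
Qed.

Lemma cov_add u A B x : msmooth U A -> msmooth U B -> U x ->
  cov u (fun y => A y + B y) x = cov u A x + cov u B x.
Proof.
move=> sA sB Ux; rewrite /cov dd_add; [|exact: dm Ux|exact: dm Ux].
by rewrite (Gam_Dr gW _ _ _ (FW Ux)) addrACA.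
Qed.

Lemma cov_scale u (f : 'rV[R]_n -> R) A x : ssmooth U f -> msmooth U A -> U x ->
  cov u (fun y => f y *: A y) x = dd u f x *: A x + f x *: cov u A x.
Proof.
move=> sf sA Ux; rewrite /cov dd_scalemx; last exact: dm Ux.
  by rewrite (Gam_Zr gW _ _ _ (FW Ux)) scalerDr addrA.
exact: ssmooth_differentiable sf Ux.
Qed.

Lemma cov_eq u A B x : (forall y, U y -> A y = B y) -> U x -> cov u A x = cov u B x.
Proof. by move=> AB Ux; rewrite /cov (dd_eq u oU Ux AB) AB. Qed.

End CovariantAlongMap.

(** * Curvature *)

Section CurvatureSymmetries.
Variables (R : realType) (d : nat).
Variables (W : set 'rV[R]_d) (g : 'rV[R]_d -> 'M[R]_d).
Hypothesis gW : metric_on W g.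
Implicit Types (a b c e y : 'rV[R]_d) (V : 'rV[R]_d -> 'rV[R]_d).

Let oW : open W. Proof. by case: gW. Qed.
Let sg : msmooth W g. Proof. by case: gW. Qed.

Lemma smooth_map_id : smooth_map W W (fun y : 'rV[R]_d => y).
Proof. by split=> //; exact: msmooth_id. Qed.

Definition nab u V y : 'rV[R]_d := cov g (fun z => z) u V y.

Lemma nabE u V y : nab u V y = dd u V y + Gam g y u (V y).
Proof. by rewrite /nab /cov dd_id. Qed.

Lemma levi_civitaE (X Y : 'rV[R]_d -> 'rV[R]_d) y : levi_civita g X Y y = nab (X y) Y y.
Proof. by rewrite nabE /levi_civita ddE GamE. Qed.

Lemma nab_cst u c y : nab u (fun=> c) y = Gam g y u c.
Proof. by rewrite nabE dd_cst add0r. Qed.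

Lemma msmooth_nab u V : msmooth W V -> msmooth W (nab u V).
Proof. exact: (msmooth_cov gW smooth_map_id). Qed.

Lemma nab_nab u v V y : msmooth W V -> W y ->
  nab u (nab v V) y - nab v (nab u V) y = riem g y u v (V y).
Proof.
by move=> sV Wy; rewrite /nab (cov_cov gW smooth_map_id) // !dd_id.
Qed.

Lemma nab_metric (A B : 'rV[R]_d -> 'rV[R]_d) u y :
  msmooth W A -> msmooth W B -> W y ->
  dd u (fun z => inner (g z) (A z) (B z)) y =
    inner (g y) (nab u A y) (B y) + inner (g y) (A y) (nab u B y).
Proof. exact: (cov_metric gW smooth_map_id). Qed.

Lemma riemannE a b c y : W y ->
  riemann g (cst a) (cst b) (cst c) y = riem g y a b c.
Proof.
move=> Wy; rewrite -(nab_nab a b (msmooth_cst W c) Wy) /riemann !levi_civitaE /cst.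
have E u : levi_civita g (fun=> u) (fun=> c) = nab u (fun=> c).
  by apply/funext => z; rewrite levi_civitaE.
rewrite !E [X in _ - X](_ : _ = 0) ?subr0 // nab_cst /bracket !ddE !dd_cst subr0.
exact: (Gam_0l gW).
Qed.

Let Gs b c : msmooth W (fun z => Gam g z b c) := msmooth_Gam_cst gW b c.
Let dG b c y (Wy : W y) := msmooth_differentiable (Gs b c) Wy.

Lemma riem_skew12 a b c y : riem g y b a c = - riem g y a b c.
Proof. by rewrite /riem opprB. Qed.

Lemma riem_linear1 k a a' b c y : W y ->
  riem g y (k *: a + a') b c = k *: riem g y a b c + riem g y a' b c.
Proof.
move=> Wy; rewrite /riem (dd_dir _ _ _ (dG b c Wy)) !(Gam_linear_l gW) //.
rewrite (@dd_eq _ _ _ W (fun z => Gam g z (k *: a + a') c)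
  (fun z => k *: Gam g z a c + Gam g z a' c)) //; last first.
  by move=> z Wz; rewrite (Gam_linear_l gW).
rewrite dd_add; [|exact: differentiableZ (dG a c Wy)|exact: dG].
rewrite dd_scalemx; [|exact: differentiable_cst|exact: dG].
rewrite dd_cst scale0r add0r (Gam_linear_r gW) //.
apply/rowP => j; rewrite !mxE; ring.
Qed.

Lemma riem_linear2 k a b b' c y : W y ->
  riem g y a (k *: b + b') c = k *: riem g y a b c + riem g y a b' c.
Proof.
by move=> Wy; rewrite riem_skew12 riem_linear1 // opprD -scalerN -!riem_skew12.
Qed.

Lemma riem_linear3 k a b c c' y : W y ->
  riem g y a b (k *: c + c') = k *: riem g y a b c + riem g y a b c'.
Proof.
move=> Wy; have E p q : dd p (fun z => Gam g z q (k *: c + c')) y =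
    k *: dd p (fun z => Gam g z q c) y + dd p (fun z => Gam g z q c') y.
  rewrite (@dd_eq _ _ _ W _ (fun z => k *: Gam g z q c + Gam g z q c')) //; last first.
    by move=> z Wz; rewrite (Gam_linear_r gW).
  rewrite dd_add; [|exact: differentiableZ (dG q c Wy)|exact: dG].
  rewrite dd_scalemx; [|exact: differentiable_cst|exact: dG].
  by rewrite dd_cst scale0r add0r.
rewrite /riem !E !(Gam_linear_r gW) //.
apply/rowP => j; rewrite !mxE; ring.
Qed.

(** On constant fields the connection is symmetric, so the six second covariant derivatives of the
    cyclic sum cancel in pairs. *)
Lemma riem_bianchi a b c y : W y ->
  riem g y a b c + riem g y b c a + riem g y c a b = 0.
Proof.
move=> Wy.
have E p q r : riem g y p q r = nab p (nab q (fun=> r)) y - nab q (nab p (fun=> r)) y.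
  by rewrite (nab_nab _ _ (msmooth_cst W r)).
have S p q r : nab p (nab q (fun=> r)) y = nab p (nab r (fun=> q)) y.
  apply: (cov_eq g smooth_map_id p _ Wy) => z Wz.
  by rewrite !nab_cst (Gam_sym gW).
rewrite !E (S b a c) (S c b a) (S a c b).
set p := nab a _ y; set q := nab b _ y; set r := nab c _ y.
by apply/rowP => j; rewrite !mxE; ring.
Qed.

(** The scalar [inner (g z) c e] has commuting second derivatives; metric compatibility turns this
    into the claim, as the mixed products cancel. *)
Lemma riem_skew34 a b c e y : W y ->
  inner (g y) (riem g y a b c) e = - inner (g y) (riem g y a b e) c.
Proof.
move=> Wy; have sc v : msmooth W (fun=> v : 'rV[R]_d) := msmooth_cst W v.
have symg : (g y)^T = g y by case: gW => _ _ + _; exact.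
pose f z := inner (g z) c e.
have sf : ssmooth W f by apply: ssmooth_inner.
have Df v z : W z -> dd v f z =
    inner (g z) (nab v (fun=> c) z) e + inner (g z) c (nab v (fun=> e) z).
  by move=> Wz; exact: (nab_metric v (sc c) (sc e) Wz).
have DDf u v : dd u (dd v f) y =
    inner (g y) (nab u (nab v (fun=> c)) y) e
    + inner (g y) (nab v (fun=> c) y) (nab u (fun=> e) y)
    + (inner (g y) (nab u (fun=> c) y) (nab v (fun=> e) y)
    + inner (g y) c (nab u (nab v (fun=> e)) y)).
  rewrite (dd_eq u oW Wy (Df v)) dd_add.
  - by rewrite !nab_metric //; exact: msmooth_nab.
  - apply: ssmooth_differentiable Wy; apply: ssmooth_inner => //; exact: msmooth_nab.
  - apply: ssmooth_differentiable Wy; apply: ssmooth_inner => //; exact: msmooth_nab.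
have := dd_comm_scalar a b oW Wy sf; rewrite !DDf => H.
rewrite -!(nab_nab _ _ (sc _) Wy) !innerBl ![inner _ _ c](innerC _ c symg).
move: H; set p1 := inner _ _ _; set p2 := inner _ _ _; set p3 := inner _ _ _.
set p4 := inner _ _ _; set p5 := inner _ _ _; set p6 := inner _ _ _ => H.
lra.
Qed.

End CurvatureSymmetries.

(** * Tensor algebra of constant phi-sectional curvature *)

Section TotallyRealCurvature.
Variables (R : realFieldType) (V : zmodType).
Variables (Q : V -> V -> V -> V -> R) (s : V -> V -> R) (ph : V -> V).
Variables (D : V -> Prop) (c : R).
Hypothesis Q1 : forall a a' b p q, Q (a + a') b p q = Q a b p q + Q a' b p q.
Hypothesis Q2 : forall a b b' p q, Q a (b + b') p q = Q a b p q + Q a b' p q.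
Hypothesis Q3 : forall a b p p' q, Q a b (p + p') q = Q a b p q + Q a b p' q.
Hypothesis Q4 : forall a b p q q', Q a b p (q + q') = Q a b p q + Q a b p q'.
Hypothesis Q12 : forall a b p q, Q b a p q = - Q a b p q.
Hypothesis Q34 : forall a b p q, Q a b q p = - Q a b p q.
Hypothesis QB : forall a b p q, Q a b p q + Q b p a q + Q p a b q = 0.
Hypothesis sD : forall a a' b, s (a + a') b = s a b + s a' b.
Hypothesis sC : forall a b, s a b = s b a.
Hypothesis phD : forall a b, ph (a + b) = ph a + ph b.
Hypothesis s_ph : forall a b, s (ph a) b = - s a (ph b).
Hypothesis DD : forall a b, D a -> D b -> D (a + b).
Hypothesis DN : forall a, D a -> D (- a).
Hypothesis Dph : forall a, D (ph a).
Hypothesis ph2 : forall a, D a -> ph (ph a) = - a.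
Hypothesis Qph : forall u v w e, D e -> Q u v (ph w) (ph e) =
  Q u v w e - s v w * s u e + s u w * s v e
  + s w (ph u) * s v (ph e) - s w (ph v) * s u (ph e).
Hypothesis Qc : forall u, D u -> Q u (ph u) (ph u) u = c * s u u ^+ 2.

(** The classical combination of four cyclic identities with the two skew symmetries. It is linear
    in the values of [Q], so [lra] finds it. *)
Lemma curv_pair_sym a b p q : Q a b p q = Q p q a b.
Proof.
have := QB a b p q; have := QB b p q a; have := QB p q a b;
have := QB q a b p; have := Q12 p a q b; have := Q34 p a b q;
have := Q34 a b p q; have := Q12 q a p b; have := Q12 q a b p;
have := Q34 b p q a; have := Q34 p q b a; have := Q12 b q p a;
have := Q34 b q a p; have := Q34 a q p b.
lra.
Qed.

Let QN1 a b p q : Q (- a) b p q = - Q a b p q.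
Proof.
have Q0 : Q 0 b p q = 0 by apply: (addrI (Q 0 b p q)); rewrite -Q1 !addr0.
by apply: (addrI (Q a b p q)); rewrite -Q1 !subrr.
Qed.
Let QN2 a b p q : Q a (- b) p q = - Q a b p q.
Proof. by rewrite Q12 QN1 -Q12. Qed.
Let QN3 a b p q : Q a b (- p) q = - Q a b p q.
Proof. by rewrite curv_pair_sym QN1 -curv_pair_sym. Qed.
Let QN4 a b p q : Q a b p (- q) = - Q a b p q.
Proof. by rewrite Q34 QN3 -Q34. Qed.
Let sN a b : s (- a) b = - s a b.
Proof.
have s0 : s 0 b = 0 by apply: (addrI (s 0 b)); rewrite -sD !addr0.
by apply: (addrI (s a b)); rewrite -sD !subrr.
Qed.
Let phN a : ph (- a) = - ph a.
Proof.
have p0 : ph 0 = 0 by apply: (addrI (ph 0)); rewrite -phD !addr0.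
by apply: (addrI (ph a)); rewrite -phD !subrr.
Qed.
Let s_ph_diag a : s a (ph a) = 0.
Proof. by have := s_ph a a; rewrite sC; lra. Qed.

(* Compares the phi-sectional curvatures of the planes of X + Y and X - Y. *)
Lemma totally_real_polarization X Y : D X -> D Y -> s X X = 1 -> s Y Y = 1 ->
  s X Y = 0 -> s X (ph Y) = 0 ->
  2 * Q X Y Y X + 6 * Q X (ph Y) (ph Y) X = 2 * c + 6.
Proof.
move=> DX DY sX sY sXY sXpY.
have sYX : s Y X = 0 by rewrite sC.
have sYpX : s Y (ph X) = 0 by rewrite sC s_ph sXpY oppr0.
have spp a b : D b -> s (ph a) (ph b) = s a b.
  by move=> Db; rewrite s_ph ph2 // sC sN opprK sC.
(* In the sum of [E1] and [E2] the terms odd in [Y] cancel, and [E3], [E4] evaluate the pure ones;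
   terms with two [X] and two [Y] remain. *)
have E1 := Qc (DD DX DY); have E2 := Qc (DD DX (DN DY)).
have E3 := Qc DX; have E4 := Qc DY.
have sp : s (X + Y) (X + Y) = 2.
  rewrite sD ![s _ (X + Y)]sC !sD sX sY sXY sYX; ring.
have sm : s (X - Y) (X - Y) = 2.
  have sNr a b : s a (- b) = - s a b by rewrite sC sN sC.
  rewrite sD ![s _ (X - Y)]sC !sD !sN !sNr sX sY sXY sYX; ring.
rewrite sp in E1; rewrite sm in E2; rewrite sX in E3; rewrite sY in E4.
rewrite !phD !(Q1, Q2, Q3, Q4) in E1.
rewrite !phD !phN !(Q1, Q2, Q3, Q4) !(QN1, QN2, QN3, QN4) in E2.
(* [Qph] removes [ph] from the last two arguments; with the Bianchi identity and pair symmetry, this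
   reduces the mixed terms to the curvatures of the planes of [X, Y] and [X, ph Y]. *)
have F1 := Qph X Y X DY.
have F2 := Qph X (ph Y) X (Dph Y).
have F3 := Qph Y (ph X) Y (Dph X).
rewrite (ph2 DY) QN4 sX sXpY in F2.
rewrite (ph2 DX) QN4 sY sYpX in F3.
rewrite sX sY sYX sXpY in F1.
rewrite !spp // sY [s X (- Y)]sC sN sYX in F2.
rewrite !spp // sX [s Y (- X)]sC sN sXY in F3.
have B1 := QB X (ph X) (ph Y) Y; have B2 := QB Y (ph Y) (ph X) X;
have G1 := Q12 Y (ph X) (ph Y) X; have G2 := curv_pair_sym (ph Y) (ph X) Y X;
have G3 := Q34 X Y X Y; have G4 := Q34 X (ph Y) X (ph Y);
have G5 := Q34 Y (ph X) Y (ph X); have G6 := Q12 (ph X) (ph Y) Y X;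
have G7 := Q34 (ph X) (ph Y) X Y; have G8 := Q34 Y (ph X) (ph Y) X;
have G9 := curv_pair_sym Y (ph X) (ph Y) X;
have G10 := Q34 (ph Y) X Y (ph X); have G11 := Q12 X (ph Y) Y (ph X);
have G12 := Q34 X (ph Y) Y (ph X); have G13 := Q12 X Y (ph X) (ph Y);
have G14 := Q34 Y X (ph X) (ph Y).
rewrite ?(s_ph_diag, sX, sY, sXY, sYX, sXpY, sYpX, mul0r, mulr0, mulr1, mul1r)
  ?(oppr0, addr0, subr0, add0r) in F1 F2 F3.
rewrite ?expr1n in E3 E4; have e2 : 2 ^+ 2 = 4 :> R by ring.
rewrite e2 in E1 E2.
clear -E1 E2 E3 E4 F1 F2 F3 B1 B2 G1 G2 G3 G4 G5 G6 G7 G8 G9 G10 G11 G12 G13 G14.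
lra.
Qed.

(** The polarized identity for [X, Y] and for [X, ph Y] is a linear system in the curvatures of
    these two planes: since [ph (ph Y) = - Y], the second instance leads back to the first plane. *)
Lemma totally_real_curvature X Y : D X -> D Y -> s X X = 1 -> s Y Y = 1 ->
  s X Y = 0 -> s X (ph Y) = 0 -> Q X Y Y X = (c + 3) / 4.
Proof.
move=> DX DY sX sY sXY sXpY.
have E1 := totally_real_polarization DX DY sX sY sXY sXpY.
have := @totally_real_polarization X (ph Y) DX (Dph Y) sX.
rewrite s_ph (ph2 DY) sC sN opprK [s X (- Y)]sC sN [s Y X]sC sXY oppr0.
rewrite QN2 QN3 opprK => /(_ sY sXpY erefl) E2.
by lra.
Qed.

End TotallyRealCurvature.

(** * Sasakian structures *)

(** The structure in a single chart, with [eta] replaced by the inner product with [xi]. The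
    derivative of [phi] is prescribed on constant fields; [cov_mul_phi] extends the identity to
    fields along a map. *)
Record sasakian_on (R : realType) (d : nat) (W : set 'rV[R]_d)
    (g : 'rV[R]_d -> 'M[R]_d) (xi : 'rV[R]_d -> 'rV[R]_d)
    (phi : 'rV[R]_d -> 'M[R]_d) : Prop := SasakianOn {
  sas_metric : metric_on W g;
  sas_xi_smooth : msmooth W xi;
  sas_phi_smooth : msmooth W phi;
  sas_xi_unit : forall y, W y -> inner (g y) (xi y) (xi y) = 1;
  sas_phi_xi : forall y, W y -> xi y *m phi y = 0;
  sas_xi_phi : forall y, W y -> forall u, inner (g y) (u *m phi y) (xi y) = 0;
  sas_phi_sqr : forall y, W y -> forall u,
    u *m phi y *m phi y = - u + inner (g y) u (xi y) *: xi y;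
  sas_metric_phi : forall y, W y -> forall u v,
    inner (g y) (u *m phi y) (v *m phi y)
    = inner (g y) u v - inner (g y) u (xi y) * inner (g y) v (xi y);
  sas_nab_phi : forall y, W y -> forall u v,
    nab g u (fun z => v *m phi z) y - nab g u (fun=> v) y *m phi y
    = inner (g y) u v *: xi y - inner (g y) v (xi y) *: u
}.

Section Sasakian.
Variables (R : realType) (d : nat) (W : set 'rV[R]_d).
Variables (g : 'rV[R]_d -> 'M[R]_d) (xi : 'rV[R]_d -> 'rV[R]_d).
Variable phi : 'rV[R]_d -> 'M[R]_d.
Hypothesis S : sasakian_on W g xi phi.
Implicit Types (u v w y : 'rV[R]_d) (V : 'rV[R]_d -> 'rV[R]_d).

Let gW := sas_metric S.
Let oW : open W. Proof. by case: gW. Qed.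
Let sg : msmooth W g. Proof. by case: gW. Qed.
Let sxi := sas_xi_smooth S.
Let sphi := sas_phi_smooth S.
Let symg y : W y -> (g y)^T = g y. Proof. by case: gW => _ _ + _; exact. Qed.

Lemma sas_phi_skew y u v : W y ->
  inner (g y) (u *m phi y) v = - inner (g y) u (v *m phi y).
Proof.
move=> Wy; have := sas_metric_phi S Wy (u *m phi y) v.
rewrite (sas_xi_phi S) // mul0r subr0 => <-; rewrite (sas_phi_sqr S) //.
rewrite innerDl innerNl innerZl (innerC (xi y) _ (symg Wy)) (sas_xi_phi S) //.
by rewrite mulr0 addr0.
Qed.

(* The Sasakian identity holds for arbitrary fields, as nabla phi is a tensor. *)
Lemma cov_mul_phi (n : nat) (U : set 'rV[R]_n) (F : 'rV[R]_n -> 'rV[R]_d)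
    (V : 'rV[R]_n -> 'rV[R]_d) (u x : 'rV[R]_n) :
  smooth_map U W F -> msmooth U V -> U x ->
  cov g F u (fun z => V z *m phi (F z)) x =
  cov g F u V x *m phi (F x) + inner (g (F x)) (dd u F x) (V x) *: xi (F x)
  - inner (g (F x)) (V x) (xi (F x)) *: dd u F x.
Proof.
move=> [oU sF FW] sV Ux; have Wy := FW x Ux.
have dphi := msmooth_differentiable sphi Wy.
have dF := msmooth_differentiable sF Ux.
have := sas_nab_phi S Wy (dd u F x) (V x); rewrite !nabE dd_mulmx //.
rewrite /cov dd_mulmx; last 2 first.
- exact: msmooth_differentiable sV Ux.
- exact: (@differentiable_comp R _ _ _ F phi).
rewrite (dd_comp _ dF dphi) !dd_cst mul0mx !add0r mulmxDl => H; rewrite -[RHS]addrA -H.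
by rewrite -!addrA; congr (_ + _); rewrite [RHS]addrC -!addrA addNr addr0.
Qed.

Lemma nab_mul_phi V u y : msmooth W V -> W y ->
  nab g u (fun z => V z *m phi z) y =
  nab g u V y *m phi y + inner (g y) u (V y) *: xi y
  - inner (g y) (V y) (xi y) *: u.
Proof.
by move=> sV Wy; rewrite /nab (cov_mul_phi u (smooth_map_id gW) sV Wy) dd_id.
Qed.

(** Differentiating [phi xi = 0] yields [phi (nab_u xi) = u - g(u, xi) xi]. Since [xi] has constant
    length, [nab_u xi] is orthogonal to it, and a second application of [phi] recovers it. *)
Lemma nab_xi u y : W y -> nab g u xi y = - (u *m phi y).
Proof.
move=> Wy; have := nab_mul_phi u sxi Wy.
have -> : nab g u (fun z => xi z *m phi z) y = 0.
  rewrite /nab (@cov_eq _ _ _ _ g _ _ (smooth_map_id gW) u _ (fun=> 0)) //.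
    by rewrite -/(nab _ _ _ _) nab_cst (Gam_0r gW).
  by move=> z Wz; rewrite (sas_phi_xi S).
rewrite (sas_xi_unit S) // scale1r => H.
have H1 : inner (g y) (nab g u xi y) (xi y) = 0.
  have := nab_metric gW u sxi sxi Wy.
  rewrite (@dd_eq R d R W _ (fun=> 1) u y oW Wy (sas_xi_unit S)) dd_cst.
  by rewrite (innerC (xi y) _ (symg Wy)); set p := inner _ _ _ => ?; lra.
have H2 : nab g u xi y *m phi y = u - inner (g y) u (xi y) *: xi y.
  by apply/eqP; rewrite -subr_eq0 opprB addrA -H.
have := sas_phi_sqr S Wy (nab g u xi y).
rewrite H1 scale0r addr0 H2 mulmxBl -scalemxAl (sas_phi_xi S) // scaler0 subr0.
by move=> ->; rewrite opprK.
Qed.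

(** The Sasakian identity is differentiated once more and skew-symmetrized. All four correction
    terms come from [nab xi = - phi]: two from the field [xi], two from the function [g(w, xi)]. *)
Lemma riem_phi u v w y : W y ->
  riem g y u v (w *m phi y) = riem g y u v w *m phi y
    - inner (g y) v w *: (u *m phi y) + inner (g y) u w *: (v *m phi y)
    + inner (g y) w (u *m phi y) *: v - inner (g y) w (v *m phi y) *: u.
Proof.
move=> Wy; have sw : msmooth W (fun=> w : 'rV[R]_d) := msmooth_cst W w.
have swp : msmooth W (fun z => w *m phi z) := msmooth_mul oW sw sphi.
have snw v' : msmooth W (nab g v' (fun=> w)) := msmooth_nab gW v' sw.
have sin (A B : 'rV[R]_d -> 'rV[R]_d) : msmooth W A -> msmooth W B ->
    ssmooth W (fun z => inner (g z) (A z) (B z)).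
  by move=> sA sB; apply: ssmooth_inner.
have E p q : nab g p (nab g q (fun z => w *m phi z)) y =
    nab g p (nab g q (fun=> w)) y *m phi y
    + inner (g y) p (nab g q (fun=> w) y) *: xi y
    - inner (g y) (nab g q (fun=> w) y) (xi y) *: p
    + (inner (g y) (nab g p (fun=> q) y) w + inner (g y) q (nab g p (fun=> w) y)) *: xi y
    - inner (g y) q w *: (p *m phi y)
    - ((inner (g y) (nab g p (fun=> w) y) (xi y) - inner (g y) w (p *m phi y)) *: q
       + inner (g y) w (xi y) *: nab g p (fun=> q) y).
  have sq : msmooth W (fun=> q : 'rV[R]_d) := msmooth_cst W q.
  rewrite [LHS](@cov_eq _ _ _ _ g _ _ (smooth_map_id gW) p _
    (fun z => nab g q (fun=> w) z *m phi z + (inner (g z) q w *: xi z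
       + (- inner (g z) w (xi z)) *: q))) //; last first.
    by move=> z Wz; rewrite (nab_mul_phi q sw Wz) scaleNr addrA.
  have s1 : msmooth W (fun z => nab g q (fun=> w) z *m phi z) by exact: msmooth_mul.
  have s2 : msmooth W (fun z => inner (g z) q w *: xi z).
    by apply: msmooth_scale => //; exact: sin.
  have s3' : ssmooth W (fun z => - inner (g z) w (xi z)).
    by move=> k; apply: diffkN => //; exact: sin.
  have s3 : msmooth W (fun z => (- inner (g z) w (xi z)) *: q).
    exact: msmooth_scale.
  have Iid := smooth_map_id gW.
  rewrite (cov_add gW Iid) //; last exact: msmooth_add.
  rewrite (cov_add gW Iid) // (cov_scale gW Iid) //; last exact: sin.
  rewrite (cov_scale gW Iid) // -!/(nab _ _ _ _) nab_mul_phi // nab_xi //.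
  rewrite (nab_metric gW) //.
  have -> : dd p (fun z => - inner (g z) w (xi z)) y =
      - (inner (g y) (nab g p (fun=> w) y) (xi y) - inner (g y) w (p *m phi y)).
    rewrite (@dd_eq R d R W _ (fun z => (-1) * inner (g z) w (xi z))) //; last first.
      by move=> z _; rewrite mulN1r.
    rewrite dd_mul; [|exact: differentiable_cst|].
      by rewrite dd_cst mul0r add0r (nab_metric gW) // nab_xi // innerNr mulN1r.
    by apply: ssmooth_differentiable Wy; exact: sin.
  set t1 := inner _ _ _; set t2 := inner _ _ _; set t3 := inner _ _ _.
  set t4 := inner _ _ _; set t5 := inner _ _ _; set t6 := inner _ _ _.
  set t7 := inner _ _ _; set t8 := inner _ _ _.
  set r1 := _ *m _; set r2 := xi y; set r3 := nab _ _ _ _.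
  by apply/rowP => j; rewrite !mxE; ring.
rewrite -(nab_nab gW u v swp Wy) !E -(nab_nab gW u v sw Wy) mulmxBl.
(* The terms containing the derivative of one constant field along the other cancel in the
   skew-symmetrization. *)
have Es : nab g v (fun=> u) y = nab g u (fun=> v) y.
  by rewrite !nab_cst (Gam_sym gW).
rewrite Es.
set r1 := _ *m _; set r2 := _ *m _; set r3 := xi y; set r4 := nab _ _ _ _.
by apply/rowP => j; rewrite !mxE; ring.
Qed.

End Sasakian.

Section SasakianSpaceForm.
Variables (R : realType) (d : nat) (W : set 'rV[R]_d).
Variables (g : 'rV[R]_d -> 'M[R]_d) (xi : 'rV[R]_d -> 'rV[R]_d).
Variables (phi : 'rV[R]_d -> 'M[R]_d) (c : R) (y : 'rV[R]_d).
Hypothesis S : sasakian_on W g xi phi.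
Hypothesis Wy : W y.
Hypothesis posg : forall u, u != 0 -> 0 < inner (g y) u u.
Hypothesis sectc : forall u, u != 0 -> inner (g y) u (xi y) = 0 ->
  sectional g y u (u *m phi y) = c.
Implicit Types u v : 'rV[R]_d.

Lemma sas_totally_real_curvature u v :
  inner (g y) u (xi y) = 0 -> inner (g y) v (xi y) = 0 ->
  inner (g y) u u = 1 -> inner (g y) v v = 1 -> inner (g y) u v = 0 ->
  inner (g y) u (v *m phi y) = 0 ->
  inner (g y) (riem g y u v v) u = (c + 3) / 4.
Proof.
have gW := sas_metric S.
have symg : (g y)^T = g y by case: gW => _ _ + _; exact.
apply: (@totally_real_curvature R _ (fun a b p q => inner (g y) (riem g y a b p) q)
  (inner (g y)) (fun a => a *m phi y) (fun a => inner (g y) a (xi y) = 0)).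
- move=> a a' b p q; have := riem_linear1 gW 1 a a' b p Wy.
  by rewrite !scale1r => ->; rewrite innerDl.
- move=> a b b' p q; have := riem_linear2 gW 1 a b b' p Wy.
  by rewrite !scale1r => ->; rewrite innerDl.
- move=> a b p p' q; have := riem_linear3 gW 1 a b p p' Wy.
  by rewrite !scale1r => ->; rewrite innerDl.
- by move=> a b p q q'; rewrite innerDr.
- by move=> a b p q; rewrite riem_skew12 innerNl.
- by move=> a b p q; exact: (riem_skew34 gW).
- by move=> a b p q; rewrite -!innerDl (riem_bianchi gW) // inner0l.
- by move=> a a' b; rewrite innerDl.
- by move=> a b; exact: innerC.
- by move=> a b; rewrite mulmxDl.
- by move=> a b; exact: (sas_phi_skew S).
- by move=> a b Da Db; rewrite innerDl Da Db addr0.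
- by move=> a Da; rewrite innerNl Da oppr0.
- by move=> a; exact: (sas_xi_phi S).
- by move=> a Da; rewrite (sas_phi_sqr S) // Da scale0r addr0.
- move=> a b w e De; rewrite (riem_phi S) //; move: (riem g y a b w) => r.
  rewrite !(innerDl, innerNl, innerZl, innerBl) !(sas_metric_phi S) // De; ring.
(* The quartic identity must include the zero vector. Otherwise [phi a] is orthogonal to [a] and has
   the same length, so the denominator of [sectional] is the square of [inner (g y) a a]. *)
- move=> a Da; have [->|a0] := eqVneq a 0.
    by rewrite mul0mx inner0r inner0l expr0n mulr0.
  have := sectc a0 Da; rewrite /sectional (riemannE gW) //.
  have aa := posg a0.
  have -> : inner (g y) a (a *m phi y) = 0.
    have := sas_phi_skew S a a Wy; rewrite innerC // => H.
    by lra.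
  rewrite (sas_metric_phi S) // Da mul0r subr0 expr0n subr0 => <-.
  by rewrite -expr2 divfK // expf_neq0 // gt_eqF.
Qed.

End SasakianSpaceForm.

(** * Submanifolds *)

Lemma pos_unitmx (R : realFieldType) (d : nat) (G : 'M[R]_d) :
  (forall u : 'rV[R]_d, u != 0 -> (u *m G *m u^T) 0 0 != 0) -> G \in unitmx.
Proof.
move=> posG; rewrite unitmxE unitfE; apply/det0P => -[v v0 vG].
by have := posG v v0; rewrite vG mul0mx mxE eqxx.
Qed.

Section Submanifold.
Variables (R : realType) (n d : nat).
Variables (W : set 'rV[R]_d) (g : 'rV[R]_d -> 'M[R]_d).
Hypothesis gW : metric_on W g.
Hypothesis posg : forall y, W y -> forall u, u != 0 -> 0 < inner (g y) u u.
Variables (U : set 'rV[R]_n) (F : 'rV[R]_n -> 'rV[R]_d).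
Hypothesis FUW : smooth_map U W F.
Hypothesis immF : forall x, U x -> row_free (jacobian F x).
Implicit Types (u v w z x : 'rV[R]_n).

Let oW : open W. Proof. by case: gW. Qed.
Let sg : msmooth W g. Proof. by case: gW. Qed.
Let symg y : W y -> (g y)^T = g y. Proof. by case: gW => _ _ + _; exact. Qed.
Let oU : open U. Proof. by case: FUW. Qed.
Let sF : msmooth U F. Proof. by case: FUW. Qed.
Let FW x : U x -> W (F x). Proof. by case: FUW => _ _; exact. Qed.

Lemma jacobianE u x : U x -> u *m jacobian F x = dd u F x.
Proof.
move=> Ux; rewrite -ddE deriveEjacobian //.
exact: msmooth_differentiable sF Ux.
Qed.

Lemma msmooth_jacobian : msmooth U (jacobian F).
Proof.
move=> i j; apply: ssmooth_eq oU _ (msmooth_dd (delta_mx 0 i) oU sF 0 j) => x Ux.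
by rewrite -jacobianE // -rowE mxE.
Qed.

Local Notation gM := (induced_metric g F).

Lemma induced_metricE u v x : U x ->
  inner (gM x) u v = inner (g (F x)) (dd u F x) (dd v F x).
Proof.
by move=> Ux; rewrite -!jacobianE // /inner /induced_metric trmx_mul !mulmxA.
Qed.

Lemma induced_pos x u : U x -> u != 0 -> 0 < inner (gM x) u u.
Proof.
move=> Ux u0; rewrite induced_metricE //; apply: posg; first exact: FW.
rewrite -jacobianE // -(mul0mx _ (jacobian F x)).
by apply: contra_neq u0; exact: (row_free_inj (immF Ux)).
Qed.

Lemma induced_metric_on : metric_on U gM.
Proof.
split=> //.
- apply: msmooth_mul => //; last by apply: msmooth_tr => //; exact: msmooth_jacobian.
  apply: msmooth_mul => //; first exact: msmooth_jacobian.
  exact: (msmooth_comp oU FW).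
- move=> x Ux; rewrite /induced_metric !trmx_mul trmxK mulmxA symg //; exact: FW.
- move=> x Ux; apply: pos_unitmx => u u0.
  by rewrite gt_eqF //; exact: induced_pos.
Qed.

Let gU := induced_metric_on.

Definition sff x u v : 'rV[R]_d := cov g F u (dd v F) x - dd (Gam gM x u v) F x.

Lemma second_formE x u v : U x -> second_form g F x u v = sff x u v.
Proof.
move=> Ux; rewrite /second_form ddE GamE levi_civitaE nab_cst.
rewrite /sff /cov; congr (_ + Gam g (F x) _ _ - _); last 3 first.
- exact: jacobianE.
- exact: jacobianE.
- exact: jacobianE.
by apply: (dd_eq u oU Ux) => y Uy; exact: jacobianE.
Qed.

Lemma cov_tangent_sym x u v : U x -> cov g F u (dd v F) x = cov g F v (dd u F) x.
Proof. exact: (cov_torsion gW FUW). Qed.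

Lemma msmooth_ddF u : msmooth U (dd u F).
Proof. exact: msmooth_dd. Qed.

Lemma dd_induced_metric x u v w : U x ->
  inner (dd u gM x) v w = inner (g (F x)) (cov g F u (dd v F) x) (dd w F x)
    + inner (g (F x)) (dd v F x) (cov g F u (dd w F) x).
Proof.
move=> Ux; rewrite -dd_inner_cst; last by apply: msmooth_differentiable Ux; case: gU.
rewrite (dd_eq u oU Ux (induced_metricE v w)).
by rewrite (cov_metric gW FUW) //; exact: msmooth_ddF.
Qed.

(** The induced connection is the tangential part of the ambient one: metric compatibility along [F]
    expands the derivatives of the induced metric, and the symmetry of [cov] makes the Koszul
    combination collapse. *)
Lemma Gam_inducedE x u v w : U x ->
  inner (gM x) (Gam gM x u v) w = inner (g (F x)) (cov g F u (dd v F) x) (dd w F x).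
Proof.
move=> Ux; have C a b : inner (g (F x)) a b = inner (g (F x)) b a.
  by apply: innerC; apply: symg; exact: FW.
rewrite (Gam_lower gU) // !dd_induced_metric //.
rewrite (cov_tangent_sym w u) // (cov_tangent_sym w v) // (cov_tangent_sym v u) //.
rewrite (C (dd v F x)); set p := inner _ _ _; set q := inner _ _ _; set r := inner _ _ _.
by field.
Qed.

Lemma sff_normal x u v w : U x -> inner (g (F x)) (sff x u v) (dd w F x) = 0.
Proof.
by move=> Ux; rewrite innerBl -Gam_inducedE // induced_metricE // subrr.
Qed.

Lemma sff_sym x u v : U x -> sff x u v = sff x v u.
Proof. by move=> Ux; rewrite /sff cov_tangent_sym // (Gam_sym gU). Qed.

Lemma sff_linear_l x k u u' v : U x ->
  sff x (k *: u + u') v = k *: sff x u v + sff x u' v.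
Proof.
move=> Ux; rewrite /sff /cov (Gam_linear_l gU) //.
have dFx := msmooth_differentiable sF Ux.
rewrite !(dd_dir _ _ _ dFx) (dd_dir _ _ _ (msmooth_differentiable (msmooth_ddF v) Ux)).
rewrite (Gam_linear_l gW) //; last exact: FW.
by apply/rowP => j; rewrite !mxE; ring.
Qed.

Lemma covE x u v : cov g F u (dd v F) x = sff x u v + dd (Gam gM x u v) F x.
Proof. by rewrite /sff subrK. Qed.

(** By [Gam_inducedE], the product of [cov_q F_* w] with [F_* z] is intrinsic. Differentiating it
    along [p], the only extra contribution is a product of two values of [sff]; skew-symmetrizing in
    [p] and [q] compares the curvatures. *)
Lemma gauss_equation x u v w z : U x ->
  inner (g (F x)) (riem g (F x) (dd u F x) (dd v F x) (dd w F x)) (dd z F x)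
  = inner (gM x) (riem gM x u v w) z
    - inner (g (F x)) (sff x v w) (sff x u z) + inner (g (F x)) (sff x u w) (sff x v z).
Proof.
move=> Ux.
have C a b : inner (g (F x)) a b = inner (g (F x)) b a.
  by apply: innerC; apply: symg; exact: FW.
have sc q : msmooth U (fun=> q : 'rV[R]_n) := msmooth_cst U q.
have E p q : inner (g (F x)) (cov g F p (cov g F q (dd w F)) x) (dd z F x) =
    inner (gM x) (nab gM p (nab gM q (fun=> w)) x) z
    - inner (g (F x)) (sff x q w) (sff x p z).
  have sq : msmooth U (cov g F q (dd w F)).
    by apply: (msmooth_cov gW FUW); exact: msmooth_ddF.
  have := cov_metric gW FUW p sq (msmooth_ddF z) Ux.
  rewrite (@dd_eq _ _ R U _ (fun y => inner (gM y) (nab gM q (fun=> w) y) z)) //;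
    last first.
    by move=> y Uy; rewrite nab_cst Gam_inducedE.
  rewrite (nab_metric gU) //; last exact: msmooth_nab.
  rewrite !nab_cst [cov g F q (dd w F) x](covE x q w) (covE x p z).
  have N a b e : inner (g (F x)) (sff x a b) (dd e F x) = 0 by exact: sff_normal.
  rewrite (innerDl _ (sff x q w)) !(innerDr _ _ (sff x p z)) N.
  rewrite (C (dd _ F x) (sff x p z)) N.
  rewrite -induced_metricE // addr0 add0r; set t := inner _ _ _ => H; lra.
rewrite -(cov_cov gW FUW u v (msmooth_ddF w) Ux) -(nab_nab gU u v (sc w) Ux).
by rewrite (innerBl _ (cov g F u _ _)) (innerBl _ (nab _ _ _ _)) !E; ring.
Qed.

End Submanifold.

(** * C-totally real immersions into a Sasakian chart *)

Section CTotallyReal.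
Variables (R : realType) (n d : nat) (W : set 'rV[R]_d).
Variables (g : 'rV[R]_d -> 'M[R]_d) (xi : 'rV[R]_d -> 'rV[R]_d).
Variable phi : 'rV[R]_d -> 'M[R]_d.
Hypothesis S : sasakian_on W g xi phi.
Hypothesis posg : forall y, W y -> forall u, u != 0 -> 0 < inner (g y) u u.
Variables (U : set 'rV[R]_n) (F : 'rV[R]_n -> 'rV[R]_d).
Hypothesis FUW : smooth_map U W F.
Hypothesis immF : forall x, U x -> row_free (jacobian F x).
Hypothesis legF : forall x, U x -> forall u, inner (g (F x)) (dd u F x) (xi (F x)) = 0.
Implicit Types (u v w z x : 'rV[R]_n).

Let gW := sas_metric S.
Let oW : open W. Proof. by case: gW. Qed.
Let sg : msmooth W g. Proof. by case: gW. Qed.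
Let symg y : W y -> (g y)^T = g y. Proof. by case: gW => _ _ + _; exact. Qed.
Let oU : open U. Proof. by case: FUW. Qed.
Let sF : msmooth U F. Proof. by case: FUW. Qed.
Let FW x : U x -> W (F x). Proof. by case: FUW => _ _; exact. Qed.
Let sdF u : msmooth U (dd u F). Proof. exact: msmooth_dd. Qed.
Local Notation gM := (induced_metric g F).
Let C x a b : U x -> inner (g (F x)) a b = inner (g (F x)) b a.
Proof. by move=> Ux; apply: innerC; apply: symg; exact: FW. Qed.

Lemma cov_comp (A : 'rV[R]_d -> 'rV[R]_d) u x : msmooth W A -> U x ->
  cov g F u (fun y => A (F y)) x = nab g (dd u F x) A (F x).
Proof.
move=> sA Ux; rewrite /cov nabE dd_comp //.
  exact: msmooth_differentiable sF Ux.
exact: msmooth_differentiable sA (FW Ux).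
Qed.

(* Differentiating <F_* v, xi> = 0 equates the symmetric form <sigma, xi> with
   the skew form <phi F_*, F_*>, so that both vanish. *)
Lemma leg_sff_xi_phi x u v : U x ->
  inner (g (F x)) (sff g F x u v) (xi (F x))
  = inner (g (F x)) (dd u F x *m phi (F x)) (dd v F x).
Proof.
move=> Ux; have sxiF : msmooth U (fun y => xi (F y)).
  by apply: (msmooth_comp oU FW sF); exact: sas_xi_smooth S.
have := cov_metric gW FUW u (sdF v) sxiF Ux.
rewrite (@dd_eq _ _ R U _ (fun=> 0)) // => [|y Uy]; last exact: legF.
rewrite dd_cst (cov_comp u (sas_xi_smooth S) Ux) (nab_xi S _ (FW Ux)).
rewrite (covE g F x u v) (innerDl _ (sff g F x u v)) legF // addr0.
by rewrite innerNr (C _ (_ *m _) Ux) => /esym/eqP; rewrite subr_eq0 => /eqP.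
Qed.

(** In [leg_sff_xi_phi] the left-hand side is symmetric in [u, v] and the right-hand side is
    skew. *)
Lemma leg_phi x u v : U x ->
  inner (g (F x)) (dd u F x *m phi (F x)) (dd v F x) = 0.
Proof.
move=> Ux; have := leg_sff_xi_phi u v Ux; have := leg_sff_xi_phi v u Ux.
rewrite (sff_sym gW posg FUW immF v u Ux) => ->.
rewrite (sas_phi_skew S _ _ (FW Ux)) (C _ _ Ux) => H.
by lra.
Qed.

Lemma leg_sff_xi x u v : U x -> inner (g (F x)) (sff g F x u v) (xi (F x)) = 0.
Proof. by move=> Ux; rewrite leg_sff_xi_phi // leg_phi. Qed.

(** In the derivative of the vanishing product of [F_* v] with [phi F_* w], the derivative of [phi]
    contributes only a multiple of [xi] and a term with the factor [g(F_* w, xi)], both lost; the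
    tangential parts vanish by [leg_phi]. *)
Lemma leg_cubic_sym x u v w : U x ->
  inner (g (F x)) (sff g F x u v) (dd w F x *m phi (F x))
  = inner (g (F x)) (sff g F x u w) (dd v F x *m phi (F x)).
Proof.
move=> Ux; have Wx := FW Ux.
have sphiF : msmooth U (fun y => phi (F y)).
  by apply: (msmooth_comp oU FW sF); exact: sas_phi_smooth S.
have sw : msmooth U (fun y => dd w F y *m phi (F y)) by exact: msmooth_mul.
have := cov_metric gW FUW u (sdF v) sw Ux.
rewrite (@dd_eq _ _ R U _ (fun=> 0)) //; last first.
  by move=> y Uy; rewrite C // leg_phi.
rewrite dd_cst (cov_mul_phi S u FUW (sdF w) Ux) legF // scale0r subr0.
rewrite innerDr innerZr legF // mulr0 addr0 -(opprK (inner _ (dd v F x) _)).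
rewrite -(sas_phi_skew S _ _ Wx) !(covE g F x u).
rewrite (innerDl _ (sff g F x u v)) (innerDr _ _ (sff g F x u w)).
rewrite [inner _ (dd (Gam _ _ _ _) _ _) _]C // !leg_phi // !addr0.
by rewrite (C (_ *m _) _ Ux) => /esym/eqP; rewrite subr_eq0 => /eqP.
Qed.

End CTotallyReal.

(** * Orthonormal frames and the defect of a cubic form *)

Section OrthonormalFrames.
Variables (R : realType) (n : nat) (G : 'M[R]_n).
Implicit Types (u v w : 'rV[R]_n) (e : 'I_n -> 'rV[R]_n).

Lemma mulmx_innerE (m p : nat) (A : 'M[R]_(m, n)) (B : 'M[R]_(p, n)) i j :
  (A *m G *m B^T) i j = inner G (row i A) (row j B).
Proof.
rewrite /inner -!row_mul mxE [RHS]mxE [RHS]mxE.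
by apply: eq_bigr => k _; rewrite !mxE.
Qed.

Lemma frame_inverse e : G \in unitmx -> orthonormal_frame G e ->
  forall i j, \sum_k e k 0 i * e k 0 j = invmx G i j.
Proof.
move=> uG oe i j; pose E : 'M[R]_n := \matrix_k e k.
have E1 : E *m G *m E^T = 1%:M.
  by apply/matrixP => k l; rewrite mulmx_innerE !rowK oe !mxE.
have E2 : G *m (E^T *m E) = 1%:M.
  by rewrite mulmxA; apply: mulmx1C; rewrite mulmxA.
have -> : invmx G = E^T *m E.
  by rewrite -(mulKmx uG (E^T *m E)) E2 mulmx1.
by rewrite mxE; apply: eq_bigr => k _; rewrite !mxE.
Qed.

Lemma frame_expand e u : G \in unitmx -> orthonormal_frame G e ->
  u = \sum_i inner G u (e i) *: e i.
Proof.
move=> uG oe; apply/rowP => j; rewrite summxE -[u in LHS](mulmxK uG) mxE.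
under eq_bigr => l _ do rewrite -(frame_inverse uG oe) mulr_sumr.
rewrite exchange_big; apply: eq_bigr => i _ /=.
rewrite mxE /inner mxE mulr_suml; apply: eq_bigr => l _.
by rewrite mulrA; congr (_ * _ * _); rewrite [RHS]mxE.
Qed.

(** The right-hand side mentions no frame. It is the form taken by [mean_curvature], and it also
    shows that a trace is the same in all orthonormal frames. *)
Lemma frame_trace (V : lmodType R) (B : 'rV[R]_n -> 'rV[R]_n -> V) e :
  G \in unitmx -> orthonormal_frame G e ->
  (forall a u u' v, B (a *: u + u') v = a *: B u v + B u' v) ->
  (forall a u v v', B u (a *: v + v') = a *: B u v + B u v') ->
  \sum_k B (e k) (e k) =
  \sum_i \sum_j invmx G i j *: B (delta_mx 0 i) (delta_mx 0 j).
Proof.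
move=> uG oe Bl Br.
have B0l v : B 0 v = 0.
  by have := Bl (-1) 0 0 v; rewrite scaler0 addr0 scaleN1r addNr.
have B0r u : B u 0 = 0.
  by have := Br (-1) u 0 0; rewrite scaler0 addr0 scaleN1r addNr.
have BDl u u' v : B (u + u') v = B u v + B u' v.
  by have := Bl 1 u u' v; rewrite !scale1r.
have BDr u v v' : B u (v + v') = B u v + B u v'.
  by have := Br 1 u v v'; rewrite !scale1r.
have BZl a u v : B (a *: u) v = a *: B u v by have := Bl a u 0 v; rewrite B0l !addr0.
have BZr a u v : B u (a *: v) = a *: B u v by have := Br a u v 0; rewrite B0r !addr0.
have E u v : B u v = \sum_i \sum_j (u 0 i * v 0 j) *: B (delta_mx 0 i) (delta_mx 0 j).
  rewrite [u in LHS]row_sum_delta.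
  rewrite (big_morph (B ^~ v) (id1 := 0) (op1 := +%R)) => [||//]; last first.
    by move=> p q; rewrite BDl.
  apply: eq_bigr => i _; rewrite BZl [v in LHS]row_sum_delta.
  rewrite (big_morph (B (delta_mx 0 i)) (id1 := 0) (op1 := +%R)) => [||//]; last first.
    by move=> p q; rewrite BDr.
  rewrite scaler_sumr; apply: eq_bigr => j _; by rewrite BZr scalerA.
under eq_bigr do rewrite E.
rewrite exchange_big; apply: eq_bigr => i _ /=.
rewrite exchange_big; apply: eq_bigr => j _ /=.
by rewrite -scaler_suml (frame_inverse uG oe).
Qed.

Hypothesis symG : G^T = G.
Hypothesis posG : forall u, u != 0 -> 0 < inner G u u.

(** The next vector is a normalized nonzero solution of the orthogonality equations to the previous
    ones, which exists as long as these are fewer than [n]. *)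
Lemma frame_extension_nat u m : (0 < m <= n)%N -> inner G u u = 1 ->
  exists e : nat -> 'rV[R]_n, e 0%N = u /\
    forall i j, (i < m)%N -> (j < m)%N -> inner G (e i) (e j) = (i == j)%:R.
Proof.
move=> + u1; elim: m => [//|[|m] IH] mn.
  exists (fun=> u); split=> // i j; rewrite !ltnS !leqn0 => /eqP -> /eqP ->.
  by rewrite u1.
have [|e [e0 oe]] := IH; first by case/andP: mn => _ /ltnW ->.
pose A : 'M[R]_(n, m.+1) := \matrix_(i, j) (G *m (e j)^T) i 0.
have K0 : kermx A != 0.
  rewrite -mxrank_eq0 mxrank_ker -lt0n subn_gt0.
  by apply: leq_ltn_trans (rank_leq_col A) _; case/andP: mn.
pose w := nz_row (kermx A).
have w0 : w != 0 by rewrite nz_row_eq0.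
have wA : w *m A = 0 by apply/eqP; rewrite -sub_kermx; exact: nz_row_sub.
have we j : (j < m.+1)%N -> inner G w (e j) = 0.
  move=> jm; have := congr1 (fun B : 'rV_m.+1 => B 0 (Ordinal jm)) wA.
  rewrite /= [RHS]mxE => <-; rewrite /inner -mulmxA !mxE.
  by apply: eq_bigr => k _; congr (_ * _); rewrite [RHS]mxE.
have ww := posG w0; pose s := Num.sqrt (inner G w w).
have s2 : s * s = inner G w w by rewrite -expr2 sqr_sqrtr // ltW.
have s0 : s != 0 by rewrite gt_eqF // sqrtr_gt0.
exists (fun k => if (k < m.+1)%N then e k else s^-1 *: w); split=> // i j.
rewrite ltnS leq_eqVlt => /orP[/eqP ->|im]; rewrite ltnS leq_eqVlt => /orP[/eqP ->|jm].
- by rewrite ltnn innerZl innerZr -s2 eqxx mulKf // mulVf.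
- by rewrite ltnn jm innerZl we // mulr0 gtn_eqF.
- by rewrite ltnn im innerZr (innerC _ _ symG) we // mulr0 ltn_eqF.
- by rewrite im jm oe.
Qed.

Lemma frame_extension u (k : 'I_n) : inner G u u = 1 ->
  exists e, orthonormal_frame G e /\ e k = u.
Proof.
move=> u1; have n0 : (0 < n <= n)%N by rewrite leqnn andbT (leq_ltn_trans _ (ltn_ord k)).
have [e [e0 oe]] := frame_extension_nat n0 u1.
pose z := Ordinal (leq_ltn_trans (leq0n k) (ltn_ord k)).
exists (fun i => e (tperm z k i)); split; last by rewrite tpermR.
by move=> i j; rewrite oe // -(inj_eq (@perm_inj _ (tperm z k))).
Qed.

End OrthonormalFrames.

(** * Sums of squares for a symmetric cubic form *)

Section CubicFormDefect.
Variables (R : realType) (n : nat) (h : 'I_n -> 'I_n -> 'I_n -> R).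
Hypothesis hn : (2 <= n)%N.
Hypothesis h12 : forall i j r, h i j r = h j i r.
Hypothesis h23 : forall i j r, h i j r = h i r j.

Let T r := \sum_j h j j r.

(** The gap between the bound and the Ricci curvature of [e_k] once the terms in [c] cancel; here
    [T] collects the components of $nH$, so $n|H|^2$ is [n^-1] times the sum of the [T r ^+ 2]. *)
Definition ricci_defect (k : 'I_n) : R :=
  (n.-1)%:R / (4 * n%:R) * (\sum_r T r ^+ 2)
  - \sum_j \sum_r (h k k r * h j j r - h k j r ^+ 2).

Let N : R := n%:R.
Let N1 : (n.-1)%:R = N - 1.
Proof. by rewrite -subn1 natrB // (leq_trans _ hn). Qed.
Let N_gt0 : 0 < N. Proof. by rewrite ltr0n (leq_trans _ hn). Qed.
Let N1_gt0 : 0 < N - 1. Proof. by rewrite -N1 ltr0n; case: n hn => [|[]]. Qed.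
Let N2_ge0 : 0 <= N - 2. Proof. by rewrite subr_ge0 ler_nat. Qed.

Let c0 : 0 < (N - 1) / (4 * N). Proof. by rewrite divr_gt0 // mulr_gt0. Qed.
Let c1 : 0 <= (N - 2) / (8 * N).
Proof. by rewrite divr_ge0 // mulr_ge0 // ltW. Qed.

Let S k := \sum_(j | j != k) h j j k.

(** Squares are completed separately for each [r]. For [r != k] the leading 2 appears because
    [h k k r] enters the sum of the [h k j r ^+ 2] both for [j = k] and, by symmetry, with the
    indices [r] and [k] exchanged. For [r = k], passing to deviations from the mean of the [n - 1]
    values [h j j k] releases [S k ^+ 2 / (N - 1)]. *)
Lemma ricci_defectE k : ricci_defect k =
  (N - 1) / (4 * N) * (h k k k - (N + 1) / (N - 1) * S k) ^+ 2
  + \sum_(j | j != k) (h j j k - S k / (N - 1)) ^+ 2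
  + \sum_(r | r != k) (2 * (h k k r - T r / 4) ^+ 2 + (N - 2) / (8 * N) * T r ^+ 2)
  + \sum_(j | j != k) \sum_(r | (r != k) && (r != j)) h k j r ^+ 2.
Proof.
have Nn0 : N != 0 by rewrite gt_eqF.
have N1n0 : N - 1 != 0 by rewrite gt_eqF.
pose rest := \sum_(j | j != k) \sum_(r | (r != k) && (r != j)) h k j r ^+ 2.
pose X2 := \sum_(j | j != k) h j j k ^+ 2.
pose A2 := \sum_(r | r != k) h k k r ^+ 2.
have E1 : \sum_j \sum_r (h k k r * h j j r) = \sum_r h k k r * T r.
  by rewrite exchange_big; apply: eq_bigr => r _ /=; rewrite mulr_sumr.
have E2 : \sum_j \sum_r h k j r ^+ 2 = h k k k ^+ 2 + 2 * A2 + X2 + rest.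
  rewrite (bigD1 k) //= (bigD1 k) //= -/A2.
  have -> : \sum_(j | j != k) \sum_r h k j r ^+ 2 = A2 + X2 + rest.
    rewrite /A2 /X2 /rest -!big_split; apply: eq_bigr => j jk /=.
    rewrite (bigD1 k) //= (bigD1 j) //= addrA (h23 k j k); congr (_ ^+ 2 + _ ^+ 2 + _).
    by rewrite h12 h23.
  ring.
have E3 : \sum_(j | j != k) (h j j k - S k / (N - 1)) ^+ 2 = X2 - S k ^+ 2 / (N - 1).
  have -> : \sum_(j | j != k) (h j j k - S k / (N - 1)) ^+ 2 =
     \sum_(j | j != k) (h j j k ^+ 2 - 2 * (S k / (N - 1)) * h j j k
       + (S k / (N - 1)) ^+ 2).
    by apply: eq_bigr => j _; ring.
  rewrite !big_split /= sumrN -mulr_sumr -/(S k) -/X2 sumr_const.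
  have -> : #|[pred j : 'I_n | j != k]| = n.-1.
    by have := cardC1 k; rewrite card_ord => <-; apply: eq_card => j; rewrite !inE.
  by rewrite -[_ *+ n.-1]mulr_natl N1; field.
have E4 : T k = h k k k + S k by rewrite /T (bigD1 k).
rewrite E3 /ricci_defect N1 -/N -/rest.
have -> : \sum_j \sum_r (h k k r * h j j r - h k j r ^+ 2) =
    \sum_j \sum_r h k k r * h j j r - \sum_j \sum_r h k j r ^+ 2.
  by rewrite -sumrB; apply: eq_bigr => j _; rewrite sumrB.
rewrite E1 E2 (bigD1 k) //= [\sum_r h k k r * T r](bigD1 k) //=.
have -> : \sum_(r | r != k) (2 * (h k k r - T r / 4) ^+ 2 + (N - 2) / (8 * N) * T r ^+ 2)
   = 2 * A2 - \sum_(r | r != k) h k k r * T r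
     + (N - 1) / (4 * N) * \sum_(r | r != k) T r ^+ 2.
  rewrite /A2 !mulr_sumr -sumrB -big_split; apply: eq_bigr => r _ /=.
  by field.
rewrite E4; set t := \sum_(_ | _) (_ ^+ 2); set t2 := \sum_(_ | _) (_ * _).
by field; rewrite ?Nn0 ?N1n0.
Qed.

Lemma ricci_defect_ge0 k : 0 <= ricci_defect k.
Proof.
rewrite ricci_defectE !addr_ge0 //.
- exact: mulr_ge0 (ltW c0) (sqr_ge0 _).
- by apply: sumr_ge0 => j _; exact: sqr_ge0.
- apply: sumr_ge0 => r _; apply: addr_ge0; last exact: mulr_ge0 c1 (sqr_ge0 _).
  by apply: mulr_ge0 (sqr_ge0 _).
- by apply: sumr_ge0 => j _; apply: sumr_ge0 => r _; exact: sqr_ge0.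
Qed.

Lemma ricci_defect_eq0 k : ricci_defect k = 0 ->
  [/\ h k k k = (N + 1) / (N - 1) * S k,
      forall j, j != k -> h j j k = S k / (N - 1),
      forall r, r != k -> h k k r = T r / 4 /\ ((2 < n)%N -> T r = 0) &
      forall j r, j != k -> r != k -> r != j -> h k j r = 0].
Proof.
move=> D0; have := D0; rewrite ricci_defectE.
set p1 := _ * _ ^+ 2.
set p2 := (X in p1 + X); set p3 := (X in p1 + p2 + X); set p4 := (X in p1 + p2 + p3 + X).
have q1 : 0 <= p1 by exact: mulr_ge0 (ltW c0) (sqr_ge0 _).
have q2 : 0 <= p2 by apply: sumr_ge0 => j _; exact: sqr_ge0.
have q3r r : 0 <= 2 * (h k k r - T r / 4) ^+ 2 + (N - 2) / (8 * N) * T r ^+ 2.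
  apply: addr_ge0; last exact: mulr_ge0 c1 (sqr_ge0 _).
  by apply: mulr_ge0 (sqr_ge0 _).
have q3 : 0 <= p3 by apply: sumr_ge0 => r _; exact: q3r.
have q4 : 0 <= p4 by apply: sumr_ge0 => j _; apply: sumr_ge0 => r _; exact: sqr_ge0.
move=> E.
have [z1 z2 z3 z4] : [/\ p1 = 0, p2 = 0, p3 = 0 & p4 = 0] by split; lra.
split.
- move/eqP: z1; rewrite mulf_eq0 gt_eqF //= sqrf_eq0 subr_eq0 => /eqP; exact.
- move=> j jk; have /eqP := psumr_eq0P (fun j _ => sqr_ge0 _) z2 jk.
  by rewrite sqrf_eq0 subr_eq0 => /eqP.
- move=> r rk; have H := psumr_eq0P (fun r _ => q3r r) z3 rk.
  have s1 := sqr_ge0 (h k k r - T r / 4).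
  have s2 : 0 <= (N - 2) / (8 * N) * T r ^+ 2 by exact: mulr_ge0 c1 (sqr_ge0 _).
  split.
    have /eqP : (h k k r - T r / 4) ^+ 2 = 0 by lra.
    by rewrite sqrf_eq0 subr_eq0 => /eqP.
  move=> n2; have /eqP : (N - 2) / (8 * N) * T r ^+ 2 = 0 by lra.
  rewrite mulf_eq0 sqrf_eq0 gt_eqF => [/eqP //|].
  by rewrite divr_gt0 ?mulr_gt0 // subr_gt0 ltr_nat.
- move=> j r jk rk rj.
  have H := psumr_eq0P (fun j _ => sumr_ge0 _ (fun r _ => sqr_ge0 _)) z4 jk.
  have /eqP : h k j r ^+ 2 = 0.
    by apply: (psumr_eq0P (fun r _ => sqr_ge0 _) H); rewrite rk rj.
  by rewrite sqrf_eq0 => /eqP.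
Qed.

Lemma ricci_defect_all0 : (2 < n)%N -> (forall k, ricci_defect k = 0) ->
  forall i j r, h i j r = 0.
Proof.
move=> n3 D0.
have T0 r : T r = 0.
  have [k kr] : exists k : 'I_n, r != k.
    have : (0 < #|predC1 r|)%N by rewrite cardC1 card_ord; case: n hn => [|[]].
    by case/card_gt0P => k; rewrite !inE => kr; exists k; rewrite eq_sym.
  by have [_ _ /(_ r kr)[_ ->]] := ricci_defect_eq0 (D0 k).
have S0 k : S k = 0 /\ h k k k = 0.
  have [Ek _ _ _] := ricci_defect_eq0 (D0 k).
  have Tk : h k k k + S k = 0 by rewrite -(T0 k) /T [RHS](bigD1 k).
  (* [h k k k] is at once [- S k] and a positive multiple of [S k], so both vanish. *)
  have : ((N + 1) / (N - 1) + 1) * S k = 0 by rewrite mulrDl mul1r -Ek.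
  move/eqP; rewrite mulf_eq0 gt_eqF /=; last first.
    by rewrite addr_gt0 // divr_gt0 // addr_gt0.
  by move/eqP => Sk0; split=> //; move: Tk; rewrite Sk0 addr0.
have xjk j k : h j j k = 0.
  have [->|jk] := eqVneq j k; first by case: (S0 k).
  have [_ /(_ j jk) -> _ _] := ricci_defect_eq0 (D0 k).
  by case: (S0 k) => -> _; rewrite mul0r.
move=> i j r.
have [<-|ji] := eqVneq j i; first exact: xjk.
have [<-|ri] := eqVneq r i; first by rewrite h23; exact: xjk.
have [<-|rj] := eqVneq r j; first by rewrite h12 h23; exact: xjk.
by have [_ _ _] := ricci_defect_eq0 (D0 i); exact.
Qed.

End CubicFormDefect.

(** * Ricci curvature of C-totally real submanifolds *)

Section LegendrianPoint.
Variables (R : realType) (n : nat).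
Local Notation d := n.*2.+1.
Variables (W : set 'rV[R]_d) (g : 'rV[R]_d -> 'M[R]_d) (xi : 'rV[R]_d -> 'rV[R]_d).
Variables (phi : 'rV[R]_d -> 'M[R]_d) (c : R).
Hypothesis hn : (2 <= n)%N.
Hypothesis S : sasakian_on W g xi phi.
Hypothesis posg : forall y, W y -> forall u, u != 0 -> 0 < inner (g y) u u.
Hypothesis sectc : forall y, W y -> forall u, u != 0 -> inner (g y) u (xi y) = 0 ->
  sectional g y u (u *m phi y) = c.
Variables (U : set 'rV[R]_n) (F : 'rV[R]_n -> 'rV[R]_d).
Hypothesis FUW : smooth_map U W F.
Hypothesis immF : forall x, U x -> row_free (jacobian F x).
Hypothesis legF : forall x, U x -> forall u, inner (g (F x)) (dd u F x) (xi (F x)) = 0.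
Variable x : 'rV[R]_n.
Hypothesis Ux : U x.
Implicit Types (u v w X : 'rV[R]_n) (e : 'I_n -> 'rV[R]_n).

Local Notation gM := (induced_metric g F).
Local Notation s := (sff g F x).
Local Notation y := (F x).
Local Notation T u := (dd u F x).

Let gW := sas_metric S.
Let Wy : W y. Proof. by case: FUW => _ _; exact. Qed.
Let symg : (g y)^T = g y. Proof. by case: gW => _ _ + _; exact. Qed.
Let ug : g y \in unitmx. Proof. by case: gW => _ _ _; exact. Qed.
Let gU : metric_on U gM := induced_metric_on gW posg FUW immF.
Let symgM : (gM x)^T = gM x. Proof. by case: gU => _ _ + _; exact. Qed.
Let ugM : gM x \in unitmx. Proof. by case: gU => _ _ _; exact. Qed.
Let C a b : inner (g y) a b = inner (g y) b a. Proof. exact: innerC. Qed.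
Let sl k u u' v : s (k *: u + u') v = k *: s u v + s u' v.
Proof. exact: (sff_linear_l gW posg FUW immF). Qed.
Let ssym u v : s u v = s v u. Proof. exact: (sff_sym gW posg FUW immF). Qed.
Let sr k u v v' : s u (k *: v + v') = k *: s u v + s u v'.
Proof. by rewrite ssym sl !(ssym u). Qed.
Let TE u v : inner (g y) (T u) (T v) = inner (gM x) u v.
Proof. by rewrite (induced_metricE g FUW). Qed.
Let phiT u v : inner (g y) (T u *m phi y) (T v) = 0.
Proof. exact: (leg_phi S posg FUW immF legF). Qed.
Let phiTT u v : inner (g y) (T u *m phi y) (T v *m phi y) = inner (gM x) u v.
Proof. by rewrite (sas_metric_phi S Wy) !legF // mul0r subr0 TE. Qed.
Let sT u v w : inner (g y) (s u v) (T w) = 0.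
Proof. exact: (sff_normal gW posg FUW immF). Qed.
Let sxi u v : inner (g y) (s u v) (xi y) = 0.
Proof. exact: (leg_sff_xi S posg FUW immF legF). Qed.

Lemma leg_sectional u v : inner (gM x) u u = 1 -> inner (gM x) v v = 1 ->
  inner (gM x) u v = 0 ->
  sectional gM x u v =
    (c + 3) / 4 + inner (g y) (s u u) (s v v) - inner (g y) (s u v) (s u v).
Proof.
move=> uu vv uv; rewrite /sectional uu vv uv expr0n subr0 mulr1 divr1.
rewrite (riemannE gU) //.
have := gauss_equation gW posg FUW immF u v v u Ux.
rewrite (sas_totally_real_curvature S Wy (posg Wy) (sectc Wy)) ?legF ?TE //; last first.
  by rewrite C phiT.
by rewrite (ssym v u) (C (s v v)) => ->; rewrite addrAC addrK subrK.
Qed.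

Section Frame.
Variable e : 'I_n -> 'rV[R]_n.
Hypothesis oe : orthonormal_frame (gM x) e.

(* F_* e_i, phi F_* e_i and xi form an orthonormal basis, by counting dimensions. *)
Lemma leg_complete (a : 'rV[R]_d) :
  (forall i, inner (g y) a (T (e i)) = 0) ->
  (forall i, inner (g y) a (T (e i) *m phi y) = 0) ->
  inner (g y) a (xi y) = 0 -> a = 0.
Proof.
move=> a1 a2 a3.
pose E1 : 'M[R]_(n, d) := \matrix_i T (e i).
pose E2 : 'M[R]_(n, d) := \matrix_i (T (e i) *m phi y).
pose B : 'M[R]_(n + n + 1, d) := col_mx (col_mx E1 E2) (xi y).
have BB : B *m g y *m B^T = 1%:M.
  rewrite !tr_col_mx !mul_col_mx !mul_mx_row.
  rewrite -[X in col_mx X _]block_mxEv block_mxEh -!block_mxEv !scalar_mx_block.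
  congr (block_mx _ _ _ _).
  - congr (block_mx _ _ _ _); apply/matrixP => i j.
    + by rewrite mulmx_innerE !rowK TE oe !mxE.
    + by rewrite mulmx_innerE !rowK C phiT !mxE.
    + by rewrite mulmx_innerE !rowK phiT !mxE.
    + by rewrite mulmx_innerE !rowK phiTT oe !mxE.
  - rewrite -col_mx0; congr col_mx; apply/matrixP => i j.
    + by rewrite mulmx_innerE !rowK row_id legF // !mxE.
    + by rewrite mulmx_innerE !rowK row_id (sas_xi_phi S Wy) !mxE.
  - rewrite -row_mx0; congr row_mx; apply/matrixP => i j.
    + by rewrite mulmx_innerE !rowK row_id C legF // !mxE.
    + by rewrite mulmx_innerE !rowK row_id C (sas_xi_phi S Wy) !mxE.
  - apply/matrixP => i j.
    by rewrite mulmx_innerE !row_id (sas_xi_unit S Wy) !ord1 !mxE.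
(* [B] has [n + n + 1 = d] rows, so an invertible Gram matrix makes it a square matrix of full
   rank. *)
have rB : row_free B^T.
  rewrite /row_free mxrank_tr eqn_leq rank_leq_col /=.
  have := mxrankM_maxl B (g y *m B^T); rewrite mulmxA BB mxrank1.
  by move: (\rank B) => k; rewrite addnn addn1.
have aB : a *m g y *m B^T = 0.
  rewrite !tr_col_mx !mul_mx_row -!row_mx0; congr (row_mx (row_mx _ _) _).
  - by apply/matrixP => i j; rewrite mulmx_innerE row_id rowK a1 mxE.
  - by apply/matrixP => i j; rewrite mulmx_innerE row_id rowK a2 mxE.
  - by apply/matrixP => i j; rewrite mulmx_innerE !row_id a3 mxE.
have ag : a *m g y = 0.
  by apply: (row_free_inj rB); rewrite aB mul0mx.
by rewrite -[a](mulmxK ug) ag mul0mx.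
Qed.

Definition hcoef i j r : R := inner (g y) (s (e i) (e j)) (T (e r) *m phi y).

(** [sff] has neither a tangential nor a [xi] component, so the difference of the two sides is
    orthogonal to the whole basis of [leg_complete]. *)
Lemma sff_expand u v :
  s u v = \sum_r inner (g y) (s u v) (T (e r) *m phi y) *: (T (e r) *m phi y).
Proof.
apply/eqP; rewrite -subr_eq0; apply/eqP; apply: leg_complete => [i|i|].
- rewrite (innerBl _ (s u v)) sT inner_suml big1 ?subr0 // => r _.
  by rewrite innerZl phiT mulr0.
- rewrite (innerBl _ (s u v)) inner_suml (bigD1 i) //= innerZl phiTT oe eqxx mulr1.
  rewrite big1 ?addr0 ?subrr // => r ri.
  by rewrite innerZl phiTT oe (negPf ri) mulr0.
- rewrite (innerBl _ (s u v)) sxi inner_suml big1 ?subr0 // => r _.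
  by rewrite innerZl (sas_xi_phi S Wy) mulr0.
Qed.

Lemma inner_sff u v (b : 'rV[R]_d) :
  inner (g y) (s u v) b =
  \sum_r inner (g y) (s u v) (T (e r) *m phi y) * inner (g y) b (T (e r) *m phi y).
Proof.
rewrite {1}sff_expand inner_suml; apply: eq_bigr => r _.
by rewrite innerZl (C _ b).
Qed.

Lemma leg_ricci_sum k :
  \sum_(j | j != k) sectional gM x (e k) (e j) =
  (n.-1)%:R * ((c + 3) / 4)
  + \sum_j (inner (g y) (s (e k) (e k)) (s (e j) (e j))
            - inner (g y) (s (e k) (e j)) (s (e k) (e j))).
Proof.
(* The term [j = k] is zero, which allows the sum on the right to run over all indices and hence to
   be a trace. *)
rewrite [in RHS](bigD1 k) //= subrr add0r.
have -> : (n.-1)%:R * ((c + 3) / 4) = \sum_(j : 'I_n | j != k) ((c + 3) / 4).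
  rewrite sumr_const mulr_natl; congr (_ *+ _).
  by have := cardC1 k; rewrite card_ord => <-; apply: eq_card => j; rewrite !inE.
rewrite -big_split; apply: eq_bigr => j jk /=.
by rewrite leg_sectional ?oe ?eqxx ?addrA // eq_sym (negPf jk).
Qed.

End Frame.

(** The frame [e] need not contain [X]: the sum is the trace of the bilinear form [B], hence equal
    to the one over the unknown frame hidden in [ricci]. *)
Lemma leg_ricci e X : orthonormal_frame (gM x) e -> inner (gM x) X X = 1 ->
  ricci gM x X = (n.-1)%:R * ((c + 3) / 4)
  + \sum_j (inner (g y) (s X X) (s (e j) (e j)) - inner (g y) (s X (e j)) (s X (e j))).
Proof.
move=> oe XX.
pose B u v : R^o := inner (g y) (s X X) (s u v) - inner (g y) (s X u) (s X v).
have Bl a u u' v : B (a *: u + u') v = a *: B u v + B u' v.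
  rewrite /B sl sr !(innerDl, innerDr, innerZl, innerZr) /GRing.scale /=; ring.
have Br a u v v' : B u (a *: v + v') = a *: B u v + B u v'.
  by rewrite /B !sr !(innerDr, innerZr) /GRing.scale /=; ring.
have tr e' : orthonormal_frame (gM x) e' ->
    \sum_j B (e' j) (e' j) = \sum_j B (e j) (e j).
  by move=> oe'; rewrite (frame_trace ugM oe' Bl Br) (frame_trace ugM oe Bl Br).
rewrite /ricci; set A := (X in get X).
have posM u : u != 0 -> 0 < inner (gM x) u u by exact: (induced_pos posg FUW immF).
have [e0 [oe0 ek]] := frame_extension symgM posM (Ordinal (leq_trans (leqnSn 1) hn)) XX.
(* A frame through [X] exists, so [get] returns an element of the set and not its default value. *)
have : A (get A).
  apply: getPex; eexists; exists e0; eexists.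
  by split; [exact: oe0|exact: ek|].
move=> [e' [k [oe' eX ->]]]; rewrite -eX leg_ricci_sum // eX; congr (_ + _).
exact: tr.
Qed.

Lemma leg_mean_curvature e : orthonormal_frame (gM x) e ->
  mean_curvature g F x = n%:R^-1 *: \sum_j s (e j) (e j).
Proof.
move=> oe; rewrite /mean_curvature (frame_trace ugM oe sl sr).
congr (_ *: _); apply: eq_bigr => i _; apply: eq_bigr => j _.
by rewrite (second_formE g FUW).
Qed.

Lemma leg_defect e k : orthonormal_frame (gM x) e ->
  (n.-1)%:R / 4 *
    (c + 3 + n%:R * inner (g y) (mean_curvature g F x) (mean_curvature g F x))
  - ricci gM x (e k) = ricci_defect (hcoef e) k.
Proof.
move=> oe; rewrite (leg_ricci oe); last by rewrite oe eqxx.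
rewrite (leg_mean_curvature oe) innerZl innerZr /ricci_defect.
have n0 : n%:R != 0 :> R by rewrite pnatr_eq0 -lt0n (leq_trans _ hn).
have -> : inner (g y) (\sum_j s (e j) (e j)) (\sum_j s (e j) (e j)) =
    \sum_r (\sum_j hcoef e j j r) ^+ 2.
  rewrite inner_suml.
  under eq_bigr => i _ do rewrite (inner_sff oe).
  rewrite exchange_big; apply: eq_bigr => r _ /=.
  by rewrite inner_suml expr2 mulr_suml.
have -> : \sum_j (inner (g y) (s (e k) (e k)) (s (e j) (e j))
     - inner (g y) (s (e k) (e j)) (s (e k) (e j))) =
   \sum_j \sum_r (hcoef e k k r * hcoef e j j r - hcoef e k j r ^+ 2).
  apply: eq_bigr => j _; rewrite !(inner_sff oe (e k)) -sumrB.
  by apply: eq_bigr => r _; rewrite expr2.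
by field.
Qed.

Let posM u : u != 0 -> 0 < inner (gM x) u u.
Proof. exact: (induced_pos posg FUW immF). Qed.

(** All the data depend on [n], so [n = 2] is not substituted; rewriting sums over ['I_n] is
    enough. *)
Let two_indices (hn2 : n = 2%N) : exists k0 k1 : 'I_n, k1 != k0 /\
  forall (V : nmodType) (f : 'I_n -> V),
    \sum_i f i = f k0 + f k1 /\ \sum_(i | i != k0) f i = f k1
    /\ \sum_(i | i != k1) f i = f k0.
Proof.
have l0 : (0 < n)%N by rewrite hn2.
have l1 : (1 < n)%N by rewrite hn2.
exists (Ordinal l0), (Ordinal l1); split=> // V f.
have U2 (i : 'I_n) : (i == Ordinal l0) || (i == Ordinal l1).
  by case: i => [[|[|i]] hi] //; exfalso; move: hi; rewrite hn2.
have P0 : \sum_(i | i != Ordinal l0) f i = f (Ordinal l1).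
  by apply: big_pred1 => i; case/orP: (U2 i) => /eqP ->.
have P1 : \sum_(i | i != Ordinal l1) f i = f (Ordinal l0).
  by apply: big_pred1 => i; case/orP: (U2 i) => /eqP ->.
by split=> //; rewrite (bigD1 (Ordinal l0)) //= P0.
Qed.

Local Notation H := (mean_curvature g F x).
Local Notation bound := ((n.-1)%:R / 4 * (c + 3 + n%:R * inner (g y) H H)).
Local Notation phiN u := (T u *m phi y).

Let h12 e i j r : hcoef e i j r = hcoef e j i r.
Proof. by rewrite /hcoef ssym. Qed.
Let h23 e i j r : hcoef e i j r = hcoef e i r j.
Proof. exact: (leg_cubic_sym S posg FUW immF legF). Qed.

Lemma leg_ricci_le X : inner (gM x) X X = 1 -> ricci gM x X <= bound.
Proof.
move=> XX; have [e [oe <-]] :=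
  frame_extension symgM posM (Ordinal (leq_trans (leqnSn 1) hn)) XX.
by rewrite -subr_ge0 leg_defect //; exact: ricci_defect_ge0 hn (h12 e) (h23 e) _.
Qed.

Lemma frame_exists : exists e, orthonormal_frame (gM x) e.
Proof.
pose k := Ordinal (leq_trans (leqnSn 1) hn).
have d0 : (delta_mx 0 k : 'rV[R]_n) != 0.
  apply/eqP => /(congr1 (fun A : 'rV_n => A 0 k)) /eqP.
  by rewrite !mxE !eqxx oner_eq0.
have dd0 := posM d0; pose t := Num.sqrt (inner (gM x) (delta_mx 0 k) (delta_mx 0 k)).
have t2 : t * t = inner (gM x) (delta_mx 0 k) (delta_mx 0 k).
  by rewrite -expr2 sqr_sqrtr // ltW.
have t0 : t != 0 by rewrite gt_eqF // sqrtr_gt0.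
have [|e [oe _]] := @frame_extension _ _ _ symgM posM (t^-1 *: delta_mx 0 k) k.
  by rewrite innerZl innerZr -t2 mulKf // mulVf.
by exists e.
Qed.

Let s_comb u (f : 'I_n -> R) (p : 'I_n -> 'rV[R]_n) :
  s u (\sum_i f i *: p i) = \sum_i f i *: s u (p i).
Proof.
have s0r : s u 0 = 0 by have := sr (-1) u 0 0; rewrite scaler0 addr0 scaleN1r addNr.
apply: (big_ind2 (fun q q' => s u q = q')) => [|q q' z z' <- <-|i _] //.
  by have := sr 1 u q z; rewrite !scale1r.
by rewrite -[_ *: p i]addr0 sr s0r addr0.
Qed.

Let sff_frame0 e : orthonormal_frame (gM x) e ->
  (forall i j, s (e i) (e j) = 0) -> forall u v, s u v = 0.
Proof.
move=> oe s0 u v.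
have s0v i w : s (e i) w = 0.
  by rewrite (frame_expand w ugM oe) s_comb big1 // => j _; rewrite s0 scaler0.
by rewrite (frame_expand u ugM oe) ssym s_comb big1 // => j _; rewrite ssym s0v scaler0.
Qed.

Lemma leg_equality_geodesic :
  (forall X, inner (gM x) X X = 1 -> ricci gM x X = bound) -> (2 < n)%N ->
  forall u v, s u v = 0.
Proof.
move=> Hall n3; have [e oe] := frame_exists.
have D0 k : ricci_defect (hcoef e) k = 0.
  by rewrite -leg_defect // Hall ?subrr // oe eqxx.
have h0 := ricci_defect_all0 hn (h12 e) (h23 e) n3 D0.
apply: (sff_frame0 oe) => i j; rewrite (sff_expand oe) big1 // => r _.
by rewrite -/(hcoef e i j r) h0 scale0r.
Qed.

Lemma leg_equality_surface :
  (forall X, inner (gM x) X X = 1 -> ricci gM x X = bound) -> n = 2%N ->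
  exists (e1 e2 : 'rV[R]_n) (mu : R),
    [/\ inner (gM x) e1 e1 = 1, inner (gM x) e2 e2 = 1 & inner (gM x) e1 e2 = 0] /\
    [/\ s e1 e1 = (3 * mu) *: phiN e1, s e2 e2 = mu *: phiN e1 &
        s e1 e2 = mu *: phiN e2].
Proof.
move=> Hall n2; have [k0 [k1 [k10 sum2]]] := two_indices n2.
have [e oe] := frame_exists.
(* The tangent vector with $nH = \varphi F_* w$. *)
pose w := \sum_r (\sum_j hcoef e j j r) *: e r.
have Tsum (I : Type) (r : seq I) (f : I -> R) (p : I -> 'rV[R]_n) :
    T (\sum_(i <- r) f i *: p i) = \sum_(i <- r) f i *: T (p i).
  rewrite -(jacobianE FUW _ Ux) mulmx_suml; apply: eq_bigr => i _.
  by rewrite -scalemxAl (jacobianE FUW _ Ux).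
have wH : \sum_j s (e j) (e j) = phiN w.
  rewrite Tsum mulmx_suml.
  under [RHS]eq_bigr => r _ do rewrite -scalemxAl scaler_suml.
  rewrite exchange_big; apply: eq_bigr => j _ /=.
  exact: (sff_expand oe).
have [f [of_ wf]] : exists f, orthonormal_frame (gM x) f /\ inner (gM x) w (f k1) = 0.
  (* When $H = 0$ there is no preferred direction, and any frame will do. *)
  have [w0|w0] := eqVneq w 0; first by exists e; rewrite w0 inner0l.
  have ww := posM w0; pose t := Num.sqrt (inner (gM x) w w).
  have t2 : t * t = inner (gM x) w w by rewrite -expr2 sqr_sqrtr // ltW.
  have t0 : t != 0 by rewrite gt_eqF // sqrtr_gt0.
  have [|f [of_ fk]] := @frame_extension _ _ _ symgM posM (t^-1 *: w) k0.
    by rewrite innerZl innerZr -t2 mulKf // mulVf.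
  exists f; split=> //; have := of_ k0 k1; rewrite fk innerZl eq_sym (negPf k10).
  by move/eqP; rewrite mulf_eq0 invr_eq0 (negPf t0) => /eqP.
(* This trace is the product of [phi F_* w] with [phi F_* (f k1)], hence that of [w] with [f k1]. *)
have T1 : \sum_j hcoef f j j k1 = 0.
  rewrite /hcoef -inner_suml (frame_trace ugM of_ sl sr) -(frame_trace ugM oe sl sr).
  by rewrite wH phiTT.
have D0 k : ricci_defect (hcoef f) k = 0.
  by rewrite -leg_defect // Hall ?subrr // of_ eqxx.
have [A0 _ B0 _] := ricci_defect_eq0 hn (h12 f) (h23 f) (D0 k0).
have [A1 _ _ _] := ricci_defect_eq0 hn (h12 f) (h23 f) (D0 k1).
have [h001 _] := B0 k1 k10; rewrite T1 mul0r in h001.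
rewrite (sum2 _ _).2.2 h001 mulr0 in A1.
rewrite (sum2 _ _).2.1 in A0.
(* The origin of the 3 in the normal form: [A0] says that [hcoef f k0 k0 k0] is this ratio times
   [hcoef f k1 k1 k0], which serves as [mu]. *)
have E3 : (n%:R + 1) / (n%:R - 1) = 3 :> R by rewrite n2; field.
rewrite E3 in A0.
exists (f k0), (f k1), (hcoef f k1 k1 k0); split.
  by rewrite !of_ !eqxx eq_sym (negPf k10).
have Ex i j : s (f i) (f j) =
    hcoef f i j k0 *: phiN (f k0) + hcoef f i j k1 *: phiN (f k1).
  by rewrite (sff_expand of_) (sum2 _ _).1.
split; rewrite Ex.
- by rewrite A0 h001 scale0r addr0.
- by rewrite A1 scale0r addr0.
- by rewrite (h23 _ k0 k1) h001 scale0r add0r h12 (h23 _ k1 k0).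
Qed.

Lemma leg_geodesic_equality X : (forall u v, s u v = 0) ->
  inner (gM x) X X = 1 -> ricci gM x X = bound.
Proof.
move=> s0 XX; have [e oe] := frame_exists.
rewrite (leg_ricci oe XX) (leg_mean_curvature oe).
rewrite !big1 => [|j _|j _]; rewrite ?s0 ?inner0l ?subr0 //.
by rewrite scaler0 inner0l; field.
Qed.

(** With [X = a e1 + b e2], the Ricci curvature is [(c + 3) / 4 + 2 mu^2 (a^2 + b^2)], which does
    not depend on the direction, while $H = 2\mu\varphi e_1$ gives the bound the same value. *)
Lemma leg_surface_equality (X e1 e2 : 'rV[R]_n) (mu : R) : n = 2%N ->
  inner (gM x) e1 e1 = 1 -> inner (gM x) e2 e2 = 1 -> inner (gM x) e1 e2 = 0 ->
  s e1 e1 = (3 * mu) *: phiN e1 -> s e2 e2 = mu *: phiN e1 ->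
  s e1 e2 = mu *: phiN e2 ->
  inner (gM x) X X = 1 -> ricci gM x X = bound.
Proof.
move=> n2 e11 e22 e12 s11 s22 s12 XX.
have [k0 [k1 [k10 sum2]]] := two_indices n2.
have e21 : inner (gM x) e2 e1 = 0 by rewrite innerC.
pose e i := if i == k0 then e1 else e2.
have ek0 : e k0 = e1 by rewrite /e eqxx.
have ek1 : e k1 = e2 by rewrite /e (negPf k10).
have ik (i : 'I_n) : i = k0 \/ i = k1.
  have [->|i0] := eqVneq i k0; [by left|right].
  apply/eqP/negPn/negP => i1.
  (* An index other than [k0] and [k1] would make the sum of its indicator function both 1 and 0. *)
  have := (sum2 _ (fun j => (j == i)%:R : R)).1.
  rewrite (bigD1 i) //= eqxx big1 => [|j /negPf -> //].
  rewrite ![_ == i]eq_sym (negPf i0) (negPf i1) !addr0 => /eqP.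
  by rewrite oner_eq0.
have oe : orthonormal_frame (gM x) e.
  move=> i j; case: (ik i) => ->; case: (ik j) => ->;
  by rewrite ?ek0 ?ek1 ?eqxx ?[k0 == k1]eq_sym ?(negPf k10) ?e11 ?e22 ?e12 ?e21.
rewrite (leg_ricci oe XX) (leg_mean_curvature oe) !(sum2 _ _).1 ek0 ek1.
have EX := frame_expand X ugM oe; rewrite (sum2 _ _).1 ek0 ek1 in EX.
set a := inner (gM x) X e1 in EX; set b := inner (gM x) X e2 in EX.
have ab : a ^+ 2 + b ^+ 2 = 1.
  by rewrite -XX {2}EX innerDr !innerZr -/a -/b !expr2.
have s21 : s e2 e1 = mu *: phiN e2 by rewrite ssym.
have sX z : s z X = a *: s z e1 + b *: s z e2.
  rewrite [X in LHS](frame_expand X ugM oe) s_comb (sum2 _ _).1 ek0 ek1.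
  by [].
have sX1 : s X e1 = (3 * a * mu) *: phiN e1 + (b * mu) *: phiN e2.
  by rewrite ssym sX s11 s12 !scalerA; congr (_ *: _ + _); ring.
have sX2 : s X e2 = (b * mu) *: phiN e1 + (a * mu) *: phiN e2.
  by rewrite ssym sX s21 s22 !scalerA addrC.
have sXX : s X X = ((3 * a ^+ 2 + b ^+ 2) * mu) *: phiN e1 + (2 * a * b * mu) *: phiN e2.
  rewrite sX sX1 sX2; apply/rowP => j; rewrite !mxE; ring.
have nR : n%:R = 2 :> R by rewrite n2.
have n1R : (n.-1)%:R = 1 :> R by rewrite n2.
rewrite sXX sX1 sX2 s11 s22 nR n1R.
rewrite !(innerDl, innerDr, innerZl, innerZr, phiTT) e11 e22 e12 e21.
transitivity ((c + 3) / 4 + 2 * mu ^+ 2 * (a ^+ 2 + b ^+ 2)); first by field.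
by rewrite ab; field.
Qed.

End LegendrianPoint.

(** * From manifolds to charts *)

Lemma Ck_eq (R : realType) (d k : nat) (U : set 'rV[R]_d) (f h : 'rV[R]_d -> R) :
  open U -> (forall x, U x -> f x = h x) -> Ck k U f -> Ck k U h.
Proof.
move=> oU; elim: k f h => [|k IH] f h fh [cf Df]; split.
- by apply: (@diffk_eq _ _ 0 U f h).
- by [].
- by apply: (@diffk_eq _ _ 0 U f h).
move=> j; have [df CD] := Df j; split=> [x Ux|].
  apply: near_eq_derivable (df x Ux); exact: near_eq_open fh.
by apply: IH CD; exact: derive_eq_open.
Qed.

Lemma Ck_entry (R : realType) (d m n k : nat) (U : set 'rV[R]_d)
    (A : 'rV[R]_d -> 'M[R]_(m, n)) i j :
  open U -> Ck k U A -> Ck k U (fun x => A x i j).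
Proof.
move=> oU; elim: k A => [|k IH] A [cA DA].
  split=> // x Ux.
  apply: (@continuous_comp _ _ _ A (fun N : 'M[R]_(m, n) => N i j)).
    exact: cA.
  exact: coord_continuous.
split=> [x Ux|l].
  apply: (@continuous_comp _ _ _ A (fun N : 'M[R]_(m, n) => N i j)).
    exact: cA.
  exact: coord_continuous.
have [dA CA] := DA l; split=> [x Ux|].
  by move/derivable_mxP: (dA x Ux); exact.
apply: Ck_eq oU _ (IH _ CA) => x Ux.
by rewrite derive_mx ?mxE //; exact: dA.
Qed.

Lemma smooth_msmooth (R : realType) (d m n : nat) (U : set 'rV[R]_d)
    (A : 'rV[R]_d -> 'M[R]_(m, n)) : open U -> smooth U A -> msmooth U A.
Proof. by move=> oU sA i j k; apply: Ck_diffk => //; exact: Ck_entry. Qed.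

Lemma sasakian_on_chart (R : realType) (m : nat) (N : manifold R m.*2.+1)
    (S : contact_metric N) (a : chart N) : sasakian S ->
  sasakian_on (chart_cod a) (metric S a) (xi S a) (phi S a).
Proof.
move=> hS; have oW : open (chart_cod a) by exact: chart_cod_open.
have gW : metric_on (chart_cod a) (metric S a).
  split=> //.
  - by apply: smooth_msmooth => //; exact: metric_smooth.
  - by move=> y Wy; exact: Defs.metric_sym.
  - move=> y Wy; apply: pos_unitmx => u u0.
    by rewrite gt_eqF //; exact: metric_pos.
split=> //.
- by apply: smooth_msmooth => //; exact: xi_smooth.
- by apply: smooth_msmooth => //; exact: phi_smooth.
- by move=> y Wy; rewrite -(eta_metric S Wy) eta_xi.
- by move=> y Wy; exact: phi_xi.
- by move=> y Wy u; rewrite -(eta_metric S Wy) eta_phi.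
- by move=> y Wy u; rewrite -(eta_metric S Wy) phi_sqr.
- move=> y Wy u v; rewrite (metric_phi S Wy u v) !(eta_metric S Wy).
  by rewrite addrK.
- move=> y Wy u v; have := hS a y Wy u v.
  by rewrite /nabla_phi !levi_civitaE (eta_metric S Wy) /cst.
Qed.

Lemma local_rep_smooth_map (R : realType) (n d : nat) (M : manifold R n)
    (N : manifold R d) (f : M -> N) (i : chart M) (a : chart N) : immersion f ->
  smooth_map (local_dom f i a) (chart_cod a) (local_rep f i a).
Proof.
move=> [cf /(_ i a)[sF _]].
have oU : open (local_dom f i a).
  (* [local_dom] is defined as an image; near each of its points it contains the part of the chart's
     range that the continuous [chart_inv] sends into an open set. *)
  rewrite openE => x [q [iq aq] qx].
  have ix : chart_cod i x by exists q.
  have invx : chart_inv i x = q by rewrite -qx chart_mapK.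
  have N1 : nbhs x (chart_cod i).
    by apply: open_nbhs_nbhs; split=> //; exact: chart_cod_open.
  have N2 : nbhs q (chart_dom i `&` f @^-1` chart_dom a).
    apply: open_nbhs_nbhs; split=> //; apply: openI; first exact: chart_dom_open.
    by move/continuousP: cf; apply; exact: chart_dom_open.
  have N3 : nbhs x (chart_inv i @^-1` (chart_dom i `&` f @^-1` chart_dom a)).
    by apply: (chart_inv_continuous ix); rewrite invx.
  apply: filterS (filterI N1 N3) => x' [[q' iq' q'x'] Hx'].
  by exists q' => //; move: Hx'; rewrite /= -q'x' chart_mapK.
split=> //; first exact: smooth_msmooth.
move=> x [q [iq aq] <-]; exists (f q) => //.
by rewrite /local_rep /= chart_mapK.
Qed.

Theorem theorem6p1 (R : realType) (n : nat) (hn : (2 <= n)%N) (c : R)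
    (N : manifold R n.*2.+1) (S : contact_metric N)
    (hS : sasakian_space_form S c)
    (M : manifold R n) (f : M -> N) (hf : immersion f)
    (hC : C_totally_real S f)
    (p : M) (i : chart M) (a : chart N)
    (hi : chart_dom i p) (ha : chart_dom a (f p)) :
  let x := chart_map i p in
  let F := local_rep f i a in
  let gN := metric S a in
  let gM := induced_metric gN F in
  let sigma := second_form gN F x in
  let H := mean_curvature gN F x in
  let bound := (n.-1)%:R / 4 * (c + 3 + n%:R * inner (gN (F x)) H H) in
  let phiN (u : 'rV[R]_n) := u *m jacobian F x *m phi S a (F x) in
  (forall X : 'rV[R]_n, inner (gM x) X X = 1 -> ricci gM x X <= bound)
  /\
  ((forall X : 'rV[R]_n, inner (gM x) X X = 1 -> ricci gM x X = bound)
   <->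
   ((forall u v : 'rV[R]_n, sigma u v = 0)
    \/
    (n = 2%N /\
     exists (e1 e2 : 'rV[R]_n) (mu : R),
       [/\ inner (gM x) e1 e1 = 1, inner (gM x) e2 e2 = 1 &
           inner (gM x) e1 e2 = 0] /\
       [/\ sigma e1 e1 = (3 * mu) *: phiN e1,
           sigma e2 e2 = mu *: phiN e1 &
           sigma e1 e2 = mu *: phiN e2]))).
Proof.
move=> x F gN gM sigma H bound phiN.
have [sasS sectS] := hS.
have S' := sasakian_on_chart a sasS.
have FUW := local_rep_smooth_map i a hf.
pose U := local_dom f i a.
have posN y : chart_cod a y -> forall u, u != 0 -> 0 < inner (gN y) u u.
  exact: metric_pos.
have immF y : U y -> row_free (jacobian F y) by case: hf => _ /(_ i a)[_]; exact.
have FW y : U y -> chart_cod a (F y) by case: FUW => _ _; exact.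
(* Being in the kernel of [eta] is orthogonality to [xi], the form used in the local results. *)
have legF y : U y -> forall u, inner (gN (F y)) (dd u F y) (xi S a (F y)) = 0.
  move=> Uy u; rewrite -(eta_metric S (FW _ Uy)) -(jacobianE FUW u Uy).
  exact: hC.
have sectN y : chart_cod a y -> forall u, u != 0 -> inner (gN y) u (xi S a y) = 0 ->
    sectional gN y u (u *m phi S a y) = c by exact: sectS.
have Ux : U x by exists p.
have sE u v : sigma u v = sff gN F x u v by exact: (second_formE gN FUW).
have pE u : phiN u = dd u F x *m phi S a (F x) by rewrite /phiN (jacobianE FUW u Ux).
split.
  by move=> X XX; exact: (leg_ricci_le hn S' posN sectN FUW immF legF Ux XX).
split=> [Hall|[s0|[n2 [e1 [e2 [mu [[e11 e22 e12] [s11 s22 s12]]]]]]] X XX].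
- have [n2|n2] := eqVneq n 2%N.
    right; split=> //.
    have [e1 [e2 [mu [E1 [s11 s22 s12]]]]] :=
      leg_equality_surface hn S' posN sectN FUW immF legF Ux Hall n2.
    by exists e1, e2, mu; split=> //; rewrite !sE !pE.
  left=> u v; rewrite sE.
  apply: (leg_equality_geodesic hn S' posN sectN FUW immF legF Ux Hall).
  by rewrite ltn_neqAle eq_sym n2.
- apply: (leg_geodesic_equality hn S' posN sectN FUW immF legF Ux _ XX).
  by move=> u v; rewrite -sE.
- rewrite !sE !pE in s11 s22 s12.
  exact: (leg_surface_equality hn S' posN sectN FUW immF legF Ux n2
    e11 e22 e12 s11 s22 s12 XX).
Qed.
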